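(* Let $H=\sum_{\ell=1}^LH_\ell$ be a Hamiltonian on $n$ qubits and let $\mathcal{S}_k(\tau)=\prod_{j=1}^{\tilde\Upsilon_k}\mathrm{e}^{-\mathrm{i}\tau\widetilde H_j}$ be a $k$-th order Trotter formula for $H$, with $\widetilde H_j=\omega_jH_{\ell_j}$. Then the remainder Hamiltonian $G_k(s)=\mathrm{i}(\partial_s\mathcal{S}_k(s))\mathcal{S}_k^\dagger(s)-\mathcal{S}_k(s)H\mathcal{S}_k^\dagger(s)$ satisfies, for $s\ge0$, $$G_k(s)=\sum_\nu\int_0^sK_\nu(s,\sigma)\,L_\nu(s,\sigma)\,C_\nu\,L_\nu(s,\sigma)^\dagger\,d\sigma,$$ where the finite sum runs over multi-indices $\nu=(T,j,i,\vec q)$ with $T\in\{L,S\}$, $1\le j\le\tilde\Upsilon_k$, $1\le i\le n_T$ (where $n_L=j-1$, $n_S=\tilde\Upsilon_k$), and $\vec q=(q_i,\dots,q_{n_T})$ non-negative integers with $q_i\ge1$ and $q_i+\dots+q_{n_T}=k$, and where: (i) $C_\nu=\varepsilon_T(-\mathrm{i})^k\,\mathrm{ad}_{\widetilde H_i}^{q_i}\,\mathrm{ad}_{\widetilde H_{i+1}}^{q_{i+1}}\cdots\mathrm{ad}_{\widetilde H_{n_T}}^{q_{n_T}}(\widetilde H_j)$ with $\varepsilon_L=+1$, $\varepsilon_S=-1$, so that $C_\nu$ is (up to a scalar) a $k$-fold nested commutator of the components $\{H_\ell\}$; (ii) $L_\nu(s,\sigma)=\mathrm{e}^{-\mathrm{i}s\widetilde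 H_1}\cdots\mathrm{e}^{-\mathrm{i}s\widetilde H_{i-1}}\mathrm{e}^{-\mathrm{i}\sigma\widetilde H_i}$ is a partial product of Trotter factors, with $L_\nu(s,\sigma)=\mathbb{I}+\mathcal{O}(s)$ as $s\to0$ for $0\le\sigma\le s$; (iii) the kernels $$K_\nu(s,\sigma)=\frac{(s-\sigma)^{q_i-1}\,s^{q_{i+1}+\cdots+q_{n_T}}}{(q_i-1)!\,q_{i+1}!\cdots q_{n_T}!}$$ are non-negative for $0\le\sigma\le s$ and satisfy $\int_0^sK_\nu(s,\sigma)\,d\sigma=s^kw_\nu$ with $w_\nu=\dfrac1{q_i!\,q_{i+1}!\cdots q_{n_T}!}$. Hence $\|G_k(s)\|=\mathcal{O}(s^k)$ as $s\to0$.
   Context: Each $H_\ell$ is a real linear combination of mutually commuting Pauli strings (Hermitian). Products are written left to right in increasing index. A $k$-th order Trotter formula for $H$ is a product $\mathcal{S}_k(\tau)=\prod_{j=1}^{\tilde\Upsilon_k}\mathrm{e}^{-\mathrm{i}\tau\widetilde H_j}$, with $\widetilde H_j=\omega_jH_{\ell_j}$, real coefficients $\omega_j$, indices $\ell_j\in\{1,\dots,L\}$, and $\sum_j\widetilde H_j=H$, such that $\mathcal{S}_k(s)\mathrm{e}^{\mathrm{i}Hs}=\mathbb{I}+\mathcal{O}(s^{k+1})$ as $s\to0$. $\mathrm{ad}_X(Y)=[X,Y]$ and $\mathrm{ad}_X^q$ is its $q$-fold iterate ($\mathrm{ad}_X^0$ is the identity). In $\nu$, the symbols $L,S$ for $T$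 are mere labels. $G_k$ is the generator of the Trotter error: with $Q_k(s)=\mathrm{e}^{-\mathrm{i}Hs}\mathcal{S}_k(s)^\dagger$ one has $\mathrm{i}\,\partial_sQ_k^\dagger(s)=G_k(s)Q_k^\dagger(s)$. *)

(* Defs.v *)
From HB Require Import structures.
From mathcomp Require Import all_boot all_order all_algebra.
From mathcomp Require Import complex.
From mathcomp Require mxtens.
From mathcomp Require Import all_classical all_reals all_analysis.

Set Implicit Arguments.
Unset Strict Implicit.
Unset Printing Implicit Defensive.

Import Order.TTheory GRing.Theory Num.Theory.
Import numFieldNormedType.Exports.

Local Open Scope ring_scope.
Local Open Scope complex_scope.
Local Open Scope sesquilinear_scope.
Local Open Scope classical_set_scope.

Section MatrixAnalysis.
Variables (R : realType) (d : nat).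
Local Notation C := R[i].
Local Notation M := 'M[C]_d.

(* R[i] carries no topology in the libraries, so a real functional [Phi]
   (limit, derivative, integral) is applied to the real and imaginary parts of
   every entry of a matrix-valued function. *)
Definition entrywise (T : Type) (Phi : (T -> R) -> R) (F : T -> M) : M :=
  \matrix_(a, b) (Phi (fun t => complex.Re (F t a b))
                  +i* Phi (fun t => complex.Im (F t a b))).

Definition mxlim (u : nat -> M) : M := entrywise (fun v : R^nat => limn v) u.

Definition mxderive (F : R -> M) (s : R) : M :=
  entrywise (fun f : R -> R => f^`() s) F.

Definition mxint (a b : R) (F : R -> M) : M :=
  entrywise
    (fun f : R -> R => \int[@lebesgue_measure R]_(x in `[a, b]) f x) F.

Definition expmx (A : M) : M :=
  mxlim (fun N => \sum_(0 <= m < N) (m`!)%:R^-1 *: A ^+ m).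

Definition ad (X Y : M) : M := X * Y - Y * X.

Definition vnorm (v : 'cV[C]_d) : R :=
  Num.sqrt (\sum_a ComplexField.Normc.normc (v a 0) ^+ 2).

Definition opnorm (A : M) : R :=
  sup [set vnorm (A *m v) | v in [set v : 'cV[C]_d | vnorm v <= 1]].

End MatrixAnalysis.

Section Pauli.
Variable R : realType.
Local Notation C := R[i].

Variant pauli := PauliI | PauliX | PauliY | PauliZ.

Definition pauli_mx (p : pauli) : 'M[C]_2 :=
  match p with
  | PauliI => 1%:M
  | PauliX => \matrix_(a, b) (a != b)%:R
  | PauliY => \matrix_(a, b) (if a == b then 0
                              else if a == 0 then - 'i%C else 'i%C)
  | PauliZ => \matrix_(a, b) (if a != b then 0
                              else if a == 0 then 1 else -1)
  end.

(* Site 0 is the leftmost tensor factor. *)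
Fixpoint pauli_string (n : nat) : ('I_n -> pauli) -> 'M[C]_(2 ^ n) :=
  match n with
  | 0 => fun _ => 1%:M
  | m.+1 => fun P =>
      castmx (esym (expnS 2 m), esym (expnS 2 m))
        (mxtens.tensmx (pauli_mx (P ord0))
                       (pauli_string (fun a => P (lift ord0 a))))
  end.

Definition commuting_pauli_sum (n : nat) (A : 'M[C]_(2 ^ n)) : Prop :=
  exists (m : nat) (c : 'I_m -> R) (P : 'I_m -> 'I_n -> pauli),
    (forall a b, comm_mx (pauli_string (P a)) (pauli_string (P b))) /\
    A = \sum_(a < m) (c a)%:C *: pauli_string (P a).

End Pauli.

Section Trotter.
Variables (R : realType) (d : nat).
Local Notation C := R[i].
Local Notation M := 'M[C]_d.

Definition trotter_term (L U : nat) (Hl : 'I_L -> M)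
    (omega : 'I_U -> R) (ell : 'I_U -> 'I_L) (j : 'I_U) : M :=
  (omega j)%:C *: Hl (ell j).

Definition trotter (U : nat) (Ht : 'I_U -> M) (tau : R) : M :=
  \prod_(j < U) expmx (- ('i%C * tau%:C) *: Ht j).

Definition trotter_order (k : nat) (H : M) (U : nat) (Ht : 'I_U -> M) : Prop :=
  \sum_(j < U) Ht j = H /\
  (fun s : R => opnorm (trotter Ht s * expmx (('i%C * s%:C) *: H) - 1))
    =O_ (0 : R) (fun s : R => s ^+ k.+1).

Definition remainder_gen (H : M) (U : nat) (Ht : 'I_U -> M) (s : R) : M :=
  'i%C *: (mxderive (trotter Ht) s * (trotter Ht s)^t*)
  - trotter Ht s * H * (trotter Ht s)^t*.

(* [H_(l1), [H_(l2), ... [H_(lk), H_(l0)]]] for ls = [:: l1; ...; lk] *)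
Definition nested_comm (L : nat) (Hl : 'I_L -> M) (ls : seq 'I_L) (l0 : 'I_L) :=
  foldr (fun l Y => ad (Hl l) Y) (Hl l0) ls.

End Trotter.

Section MultiIndex.
Variables U k : nat.

Variant ttag := TL | TS.

Definition ttag_to_bool (T : ttag) : bool := if T is TL then true else false.
Definition bool_to_ttag (b : bool) : ttag := if b then TL else TS.
Lemma ttag_boolK : cancel ttag_to_bool bool_to_ttag. Proof. by case. Qed.
HB.instance Definition _ := Finite.copy ttag (can_type ttag_boolK).

(* Positions are counted from 0, and (q_i, ..., q_{n_T}) is padded by zeros to
   a function on all positions; entries are at most k because their sum is k
   (see [valid_midx]). *)
Record midx := Midx {
  midx_T : ttag;
  midx_j : 'I_U;
  midx_i : 'I_U;
  midx_q : {ffun 'I_U -> 'I_k.+1} }.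

Definition midx_to_prod (nu : midx) :=
  (midx_T nu, midx_j nu, midx_i nu, midx_q nu).
Definition midx_of_prod x :=
  let: (T, j, i, q) := x in Midx T j i q.
Lemma midx_prodK : cancel midx_to_prod midx_of_prod. Proof. by case. Qed.
HB.instance Definition _ := Finite.copy midx (can_type midx_prodK).

(* The active positions of [nu] are those m with midx_i nu <= m < midx_n nu. *)
Definition midx_n (nu : midx) : nat := if midx_T nu is TL then midx_j nu else U.

Definition valid_midx (nu : midx) : bool :=
  [&& (midx_i nu < midx_n nu)%N,
      [forall m : 'I_U,
         ~~ (midx_i nu <= m < midx_n nu)%N ==> (midx_q nu m == 0 :> nat)%N],
      (0 < midx_q nu (midx_i nu))%N &
      (\sum_(m < U | midx_i nu <= m < midx_n nu) midx_q nu m == k)%N].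

Section Components.
Variables (R : realType) (d : nat) (Ht : 'I_U -> 'M[R[i]]_d) (nu : midx).

Definition nu_sign : R[i] := if midx_T nu is TL then 1 else -1.

Definition nu_comm : 'M[R[i]]_d :=
  (nu_sign * (- 'i%C) ^+ k) *:
    foldr (fun m Y => iter (midx_q nu m) (ad (Ht m)) Y) (Ht (midx_j nu))
      [seq m : 'I_U <- enum 'I_U | (midx_i nu <= m < midx_n nu)%N].

Definition nu_prefix (s sigma : R) : 'M[R[i]]_d :=
  (\prod_(m < U | (m < midx_i nu)%N) expmx (- ('i%C * s%:C) *: Ht m))
  * expmx (- ('i%C * sigma%:C) *: Ht (midx_i nu)).

Definition nu_kernel (s sigma : R) : R :=
  (s - sigma) ^+ (midx_q nu (midx_i nu)).-1
  * s ^+ (\sum_(m < U | (midx_i nu < m < midx_n nu)%N) midx_q nu m)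
  / ((midx_q nu (midx_i nu)).-1`!
     * \prod_(m < U | midx_i nu < m < midx_n nu) (midx_q nu m)`!)%N%:R.

Definition nu_weight : R :=
  ((\prod_(m < U | midx_i nu <= m < midx_n nu) (midx_q nu m)`!)%N%:R)^-1.

End Components.
End MultiIndex.

(* Main.v *)
Require Import Defs.
From HB Require Import structures.
From mathcomp Require Import all_boot all_order all_algebra.
From mathcomp Require Import complex.
From mathcomp Require Import all_classical all_reals all_analysis.
From mathcomp Require Import ring lra.

Set Implicit Arguments.
Unset Strict Implicit.
Unset Printing Implicit Defensive.

Import Order.TTheory GRing.Theory Num.Theory.
Import numFieldNormedType.Exports.

Local Open Scope ring_scope.
Local Open Scope complex_scope.
Local Open Scope sesquilinear_scope.
Local Open Scope classical_set_scope.

(** Differentiating the product formula gives G(s) as the sum over j of the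
    conjugates of H~_j by the first j-1 factors, minus the sum over j of the
    conjugates of H~_j by the whole product.  In each conjugate the factors are
    expanded one at a time, from the innermost outwards, by Taylor's formula
    with integral remainder, each time to the order that completes the total
    degree to k.  The remainders are exactly the integrals indexed by nu, and
    what is left is a polynomial of degree < k in s.  This polynomial vanishes:
    Q(s) = S(s) e^{iHs} solves Q' = -i G Q, so a lowest nonzero coefficient
    B_p s^p of G would give Q - 1 the leading term -i B_p s^{p+1} / (p+1),
    against Q - 1 = O(s^{k+1}). *)

(** * Entrywise calculus *)

Section EntrywiseAnalysis.
Variable R : realType.
Local Notation C := R[i].

(** The integral formula is available only for [s >= 0], whereas the order condition and the final
    bound concern both sides of 0. Each Taylor step therefore appears in two forms drawn from one
    algebraic identity: an exact integral for [s >= 0], and an order bound [mxO] valid for either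
    sign. The order bounds yield the vanishing of the polynomial, and this in turn gives the exact
    formula.

    An order bound cannot be differentiated, so [Q - 1 = O(s^{k+1})] does not by itself make [Q']
    small. That is why [G] is compared with an explicit polynomial, whose coefficients are then
    removed by integrating the equation for [Q]. Only the difference between the polynomials of the
    L and S families vanishes: in degree 0 each of them is [H].

    The computation is done with the anti-Hermitian generators [X = -i H~], for which conjugation by
    [exp(tX)] differentiates to [ad X] with no scalar; the factor [(-i)^k] reappears at the end
    because the exponents of a multi-index sum to [k]. *)

Lemma ReD (x y : C) : complex.Re (x + y) = complex.Re x + complex.Re y.
Proof. by case: x; case: y. Qed.

Lemma ImD (x y : C) : complex.Im (x + y) = complex.Im x + complex.Im y.
Proof. by case: x; case: y. Qed.

Lemma ReM (x y : C) : complex.Re (x * y) =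
  complex.Re x * complex.Re y - complex.Im x * complex.Im y.
Proof. by case: x; case: y. Qed.

Lemma ImM (x y : C) : complex.Im (x * y) =
  complex.Re x * complex.Im y + complex.Im x * complex.Re y.
Proof. by case: x; case: y. Qed.

Lemma Re_sum (I : Type) (r : seq I) (P : pred I) (F : I -> C) :
  complex.Re (\sum_(i <- r | P i) F i) = \sum_(i <- r | P i) complex.Re (F i).
Proof. exact: (big_morph _ ReD erefl). Qed.

Lemma Im_sum (I : Type) (r : seq I) (P : pred I) (F : I -> C) :
  complex.Im (\sum_(i <- r | P i) F i) = \sum_(i <- r | P i) complex.Im (F i).
Proof. exact: (big_morph _ ImD erefl). Qed.

Lemma eq_complexP (x y : C) :
  complex.Re x = complex.Re y -> complex.Im x = complex.Im y -> x = y.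
Proof. by case: x => a b; case: y => c e /= -> ->. Qed.

Variable d : nat.
Local Notation M := 'M[C]_d.

Lemma mxME (A B : M) a b : (A * B) a b = \sum_c A a c * B c b.
Proof. by rewrite [A * B]/(A *m B) mxE. Qed.

(** A relation, because the operator [mxderive] is total and its value alone would not assert
    differentiability. *)
Definition is_dmx (F : R -> M) (s : R) (D : M) : Prop := forall a b,
  is_derive s 1 (fun t => complex.Re (F t a b)) (complex.Re (D a b)) /\
  is_derive s 1 (fun t => complex.Im (F t a b)) (complex.Im (D a b)).

Lemma is_dmx_eq F s (D D' : M) : is_dmx F s D -> D = D' -> is_dmx F s D'.
Proof. by move=> ? <-. Qed.

Lemma is_dmx_cst (A : M) s : is_dmx (fun=> A) s 0.
Proof.
by move=> a b; rewrite mxE /=; split; exact: is_derive_cst.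
Qed.

Lemma is_dmxD F G s (D E : M) :
  is_dmx F s D -> is_dmx G s E -> is_dmx (fun t => F t + G t) s (D + E).
Proof.
move=> dF dG a b; have [dF1 dF2] := dF a b; have [dG1 dG2] := dG a b.
rewrite mxE ReD ImD; split.
  by under eq_fun do rewrite mxE ReD; exact: is_deriveD.
by under eq_fun do rewrite mxE ImD; exact: is_deriveD.
Qed.

Lemma is_dmxM F G s (D E : M) : is_dmx F s D -> is_dmx G s E ->
  is_dmx (fun t => F t * G t) s (D * G s + F s * E).
Proof.
move=> dF dG a b; rewrite mxE !mxME; split.
- under eq_fun do rewrite mxME Re_sum.
  under eq_fun do under eq_bigr do rewrite ReM.
  rewrite ReD !Re_sum -big_split /=.
  have dc (c : 'I_d) : is_derive s 1 (fun t : R =>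
     complex.Re (F t a c) * complex.Re (G t c b)
      - complex.Im (F t a c) * complex.Im (G t c b))
     (complex.Re (D a c * G s c b) + complex.Re (F s a c * E c b)).
    have [dF1 dF2] := dF a c; have [dG1 dG2] := dG c b.
    apply: is_derive_eq; rewrite !ReM /GRing.scale/=; ring.
  have := @is_derive_sum _ _ _ _ _ s 1 _ dc.
  by congr is_derive; apply/funext => t; rewrite fct_sumE.
- under eq_fun do rewrite mxME Im_sum.
  under eq_fun do under eq_bigr do rewrite ImM.
  rewrite ImD !Im_sum -big_split /=.
  have dc (c : 'I_d) : is_derive s 1 (fun t : R =>
     complex.Re (F t a c) * complex.Im (G t c b)
      + complex.Im (F t a c) * complex.Re (G t c b))
     (complex.Im (D a c * G s c b) + complex.Im (F s a c * E c b)).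
    have [dF1 dF2] := dF a c; have [dG1 dG2] := dG c b.
    apply: is_derive_eq; rewrite !ImM /GRing.scale/=; ring.
  have := @is_derive_sum _ _ _ _ _ s 1 _ dc.
  by congr is_derive; apply/funext => t; rewrite fct_sumE.
Qed.

Lemma is_dmx_scalar (f : R -> R) (s f' : R) : is_derive s 1 f f' ->
  is_dmx (fun t => (f t)%:C%:M) s (f'%:C%:M).
Proof.
move=> df a b; rewrite mxE; under eq_fun do rewrite mxE.
under [X in _ /\ is_derive _ _ X _]eq_fun do rewrite mxE.
case: eqP => _ /=; rewrite ?mulr1n ?mulr0n; split => //; exact: is_derive_cst.
Qed.

Lemma is_dmxMl (A : M) F s D : is_dmx F s D -> is_dmx (fun t => A * F t) s (A * D).
Proof.
move=> dF; apply: is_dmx_eq (is_dmxM (is_dmx_cst A s) dF) _.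
by rewrite mul0r add0r.
Qed.

Lemma is_dmxMr (A : M) F s D : is_dmx F s D -> is_dmx (fun t => F t * A) s (D * A).
Proof.
move=> dF; apply: is_dmx_eq (is_dmxM dF (is_dmx_cst A s)) _.
by rewrite mulr0 addr0.
Qed.

Lemma is_dmxZ (f : R -> R) (f' : R) F (s : R) (D : M) :
  is_derive s 1 f f' -> is_dmx F s D ->
  is_dmx (fun t => (f t)%:C *: F t) s (f'%:C *: F s + (f s)%:C *: D).
Proof.
move=> df dF; under eq_fun do rewrite -mul_scalar_mx.
by rewrite -!mul_scalar_mx; apply: is_dmxM dF; exact: is_dmx_scalar.
Qed.

Lemma is_dmxZl (c : C) F s (D : M) : is_dmx F s D ->
  is_dmx (fun t => c *: F t) s (c *: D).
Proof.
move=> dF; under eq_fun do rewrite -mul_scalar_mx.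
by rewrite -!mul_scalar_mx; exact: is_dmxMl.
Qed.

Lemma is_dmxN F s (D : M) : is_dmx F s D -> is_dmx (fun t => - F t) s (- D).
Proof.
move=> /(is_dmxZl (-1)); rewrite scaleN1r; congr is_dmx.
by apply/funext => t; rewrite scaleN1r.
Qed.

Lemma is_dmxB F G s (D E : M) :
  is_dmx F s D -> is_dmx G s E -> is_dmx (fun t => F t - G t) s (D - E).
Proof. by move=> dF /is_dmxN; exact: is_dmxD. Qed.

Lemma is_dmx_sum (I : Type) (r : seq I) (P : pred I) (F : I -> R -> M) s D :
  (forall i, P i -> is_dmx (F i) s (D i)) ->
  is_dmx (fun t => \sum_(i <- r | P i) F i t) s (\sum_(i <- r | P i) D i).
Proof.
move=> dF; elim: r => [|x r IH].
  under eq_fun do rewrite big_nil; rewrite big_nil; exact: is_dmx_cst.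
under eq_fun do rewrite big_cons; rewrite big_cons.
by case: ifP => // Px; apply: is_dmxD => //; exact: dF.
Qed.

Lemma is_dmx_cst_eq (F : R -> M) s : (forall t, is_dmx F t 0) -> F s = F 0.
Proof.
move=> dF; apply/matrixP => a b; apply: eq_complexP.
  apply: (is_derive_0_is_cst (f := fun t => complex.Re (F t a b))) => t.
  by have [] := dF t a b; rewrite mxE.
apply: (is_derive_0_is_cst (f := fun t => complex.Im (F t a b))) => t.
by have [] := dF t a b; rewrite mxE.
Qed.

Lemma mxderive_val F s (D : M) : is_dmx F s D -> mxderive F s = D.
Proof.
move=> dF; apply/matrixP => a b; have [d1 d2] := dF a b.
by rewrite /mxderive /entrywise mxE !derive1E !derive_val; case: (D a b).
Qed.

Lemma Rintegral_FTC (f F : R -> R) (s : R) : 0 <= s ->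
  (forall t : R, is_derive t 1 F (f t)) -> continuous f ->
  \int[@lebesgue_measure R]_(x in `[0, s]) f x = F s - F 0.
Proof.
(* [continuous_FTC2] concerns a nondegenerate interval; at [s = 0] both sides are 0. *)
rewrite le_eqVlt => /predU1P[<-|s0] dF cf.
  by rewrite set_itv1 Rintegral_set1 subrr.
have cF : continuous F.
  by move=> t; apply: differentiable_continuous; apply/derivable1_diffP.
rewrite /Rintegral (@continuous_FTC2 _ f F)//.
- by apply: continuous_subspaceT.
- split => //.
  + by apply: cvg_at_right_filter; apply: cF.
  + by apply: cvg_at_left_filter; apply: cF.
- by move=> t _; rewrite derive1E derive_val.
Qed.

(** The derivative [E] of [D] serves to make the integrand continuous. *)
Lemma mxint_FTC (F D : R -> M) s : 0 <= s ->
  (forall t, is_dmx F t (D t)) -> (forall t, exists E, is_dmx D t E) ->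
  mxint 0 s D = F s - F 0.
Proof.
move=> s0 dF dD; apply/matrixP => a b; rewrite /mxint /entrywise !mxE.
have c1 : continuous (fun t => complex.Re (D t a b)).
  move=> t; have [E /(_ a b)[e1 _]] := dD t.
  by apply: differentiable_continuous; apply/derivable1_diffP.
have c2 : continuous (fun t => complex.Im (D t a b)).
  move=> t; have [E /(_ a b)[_ e1]] := dD t.
  by apply: differentiable_continuous; apply/derivable1_diffP.
have d1 (t : R) : is_derive t 1 (fun t => complex.Re (F t a b)) (complex.Re (D t a b)).
  by have [] := dF t a b.
have d2 (t : R) : is_derive t 1 (fun t => complex.Im (F t a b)) (complex.Im (D t a b)).
  by have [] := dF t a b.
rewrite (Rintegral_FTC s0 d1 c1) (Rintegral_FTC s0 d2 c2).
by case: (F s a b); case: (F 0 a b).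
Qed.

End EntrywiseAnalysis.

(** * Norms and order of vanishing at 0 *)

Section Norms.
Variable R : realType.
Local Notation C := R[i].
Local Notation normc := (@ComplexField.Normc.normc R).

(** The l1 norm on the plane: submultiplicative, equivalent to the modulus, and estimated on each
    real part separately without square roots. *)
Definition cnorm (z : C) : R := `|complex.Re z| + `|complex.Im z|.

Lemma cnorm_ge0 z : 0 <= cnorm z. Proof. exact: addr_ge0. Qed.

Lemma cnorm0 : cnorm 0 = 0. Proof. by rewrite /cnorm normr0 addr0. Qed.

Lemma cnormN z : cnorm (- z) = cnorm z.
Proof. by rewrite /cnorm; case: z => x y /=; rewrite !normrN. Qed.

Lemma ler_cnormD z w : cnorm (z + w) <= cnorm z + cnorm w.
Proof. by rewrite /cnorm ReD ImD addrACA lerD ?ler_normD. Qed.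

Lemma ler_cnorm_sum (I : Type) (r : seq I) (P : pred I) (F : I -> C) :
  cnorm (\sum_(i <- r | P i) F i) <= \sum_(i <- r | P i) cnorm (F i).
Proof.
elim/big_ind2: _ => [|x1 x2 y1 y2 hx hy|//]; first by rewrite cnorm0.
exact: le_trans (ler_cnormD _ _) (lerD hx hy).
Qed.

Lemma ler_cnormM z w : cnorm (z * w) <= cnorm z * cnorm w.
Proof.
rewrite /cnorm ReM ImM mulrDl !mulrDr -!normrM.
have h1 := ler_normB (complex.Re z * complex.Re w) (complex.Im z * complex.Im w).
have h2 := ler_normD (complex.Re z * complex.Im w) (complex.Im z * complex.Re w).
lra.
Qed.

Lemma cnorm_real (x : R) z : cnorm (x%:C * z) = `|x| * cnorm z.
Proof. by rewrite /cnorm ReM ImM /= !mul0r subr0 addr0 !normrM mulrDr. Qed.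

Lemma normcE z : normc z = Num.sqrt (complex.Re z ^+ 2 + complex.Im z ^+ 2).
Proof. by case: z. Qed.

Lemma normc_ge0 z : 0 <= normc z. Proof. by rewrite normcE sqrtr_ge0. Qed.

Lemma normc_le_cnorm z : normc z <= cnorm z.
Proof.
rewrite normcE -[leRHS]ger0_norm ?cnorm_ge0// -sqrtr_sqr ler_sqrt ?sqr_ge0//.
rewrite sqrrD !real_normK ?num_real// -addrA lerD2l lerDr mulrn_wge0//.
Qed.

Lemma cnorm_le_normc z : cnorm z <= 2 * normc z.
Proof.
rewrite normcE mulr_natl mulr2n lerD// -sqrtr_sqr ler_sqrt ?addr_ge0 ?sqr_ge0//.
  by rewrite lerDl sqr_ge0.
by rewrite lerDr sqr_ge0.
Qed.

Variable d : nat.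
Local Notation M := 'M[C]_d.
Implicit Types (A B : M) (F G : R -> M) (s : R).

(** A submultiplicative norm equivalent to [opnorm], so orders of vanishing can be computed on
    entries and transferred both ways. *)
Definition mnorm (A : M) : R := \sum_a \sum_b cnorm (A a b).

Lemma mnorm_ge0 A : 0 <= mnorm A.
Proof. by apply: sumr_ge0 => a _; apply: sumr_ge0 => b _; exact: cnorm_ge0. Qed.

Lemma mnorm0 : mnorm 0 = 0.
Proof. by rewrite /mnorm big1// => a _; rewrite big1// => b _; rewrite mxE cnorm0. Qed.

Lemma mnormN A : mnorm (- A) = mnorm A.
Proof. by apply: eq_bigr => a _; apply: eq_bigr => b _; rewrite mxE cnormN. Qed.

Lemma ler_mnormD A B : mnorm (A + B) <= mnorm A + mnorm B.
Proof.
rewrite /mnorm -big_split ler_sum//= => a _; rewrite -big_split ler_sum//= => b _.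
by rewrite mxE ler_cnormD.
Qed.

Lemma ler_cnorm_mnorm A a b : cnorm (A a b) <= mnorm A.
Proof.
apply: (@le_trans _ _ (\sum_c cnorm (A a c))).
  by rewrite (bigD1 b)//= lerDl sumr_ge0// => c _; exact: cnorm_ge0.
rewrite /mnorm [leRHS](bigD1 a)//= lerDl.
by apply: sumr_ge0 => ? _; apply: sumr_ge0 => ? _; exact: cnorm_ge0.
Qed.

Lemma mnorm_realZ (x : R) A : mnorm (x%:C *: A) = `|x| * mnorm A.
Proof.
rewrite /mnorm mulr_sumr; apply: eq_bigr => a _; rewrite mulr_sumr.
by apply: eq_bigr => b _; rewrite mxE cnorm_real.
Qed.

Lemma ler_mnormM A B : mnorm (A * B) <= mnorm A * mnorm B.
Proof.
rewrite {1}/mnorm /(mnorm A) mulr_suml; apply: ler_sum => a _.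
apply: (@le_trans _ _ (\sum_b \sum_c cnorm (A a c) * cnorm (B c b))).
  apply: ler_sum => b _; rewrite mxME; apply: le_trans (ler_cnorm_sum _ _ _) _.
  by apply: ler_sum => c _; exact: ler_cnormM.
rewrite exchange_big /= mulr_suml; apply: ler_sum => c _.
rewrite -mulr_sumr ler_wpM2l ?cnorm_ge0// /mnorm [leRHS](bigD1 c)//= lerDl.
by apply: sumr_ge0 => ? _; apply: sumr_ge0 => ? _; exact: cnorm_ge0.
Qed.

(** The factor [mnorm 1] is the dimension, not 1, and is needed at [m = 0]. *)
Lemma ler_mnormX A m : mnorm (A ^+ m) <= mnorm 1 * mnorm A ^+ m.
Proof.
elim: m => [|m IH]; first by rewrite !expr0 mulr1.
rewrite exprSr exprSr mulrA; apply: le_trans (ler_mnormM _ _) _.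
by rewrite ler_wpM2r ?mnorm_ge0.
Qed.

Lemma vnorm_ge0 (v : 'cV[C]_d) : 0 <= vnorm v. Proof. exact: sqrtr_ge0. Qed.

Lemma normc_le_vnorm (v : 'cV[C]_d) a : normc (v a 0) <= vnorm v.
Proof.
rewrite -[leLHS]ger0_norm ?normc_ge0// -sqrtr_sqr ler_sqrt; last first.
  by apply: sumr_ge0 => b _; exact: sqr_ge0.
by rewrite [leRHS](bigD1 a)//= lerDl; apply: sumr_ge0 => b _; exact: sqr_ge0.
Qed.

Lemma vnorm_le_sum (v : 'cV[C]_d) : vnorm v <= \sum_a normc (v a 0).
Proof.
have s0 : 0 <= \sum_a normc (v a 0) by apply: sumr_ge0 => a _; exact: normc_ge0.
rewrite -[leRHS]ger0_norm// -sqrtr_sqr ler_sqrt ?sqr_ge0//.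
rewrite [leRHS]expr2 mulr_suml; apply: ler_sum => a _; rewrite expr2.
rewrite ler_wpM2l ?normc_ge0// [leRHS](bigD1 a)//= lerDl.
by apply: sumr_ge0 => b _; exact: normc_ge0.
Qed.

Lemma vnorm_mulmx_le (A : M) v : vnorm v <= 1 -> vnorm (A *m v) <= 2 * mnorm A.
Proof.
move=> v1; apply: le_trans (vnorm_le_sum _) _; rewrite mulr_sumr.
apply: ler_sum => a _; apply: le_trans (normc_le_cnorm _) _.
rewrite mxE mulr_sumr; apply: le_trans (ler_cnorm_sum _ _ _) _.
apply: ler_sum => b _; apply: le_trans (ler_cnormM _ _) _.
rewrite mulrC ler_wpM2r ?cnorm_ge0//; apply: le_trans (cnorm_le_normc _) _.
by rewrite -[leRHS]mulr1 ler_wpM2l// (le_trans (normc_le_vnorm _ _)).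
Qed.

Lemma vnorm0 : vnorm (0 : 'cV[C]_d) = 0.
Proof.
apply/eqP; rewrite eq_le vnorm_ge0 andbT (le_trans (vnorm_le_sum _))// big1// => a _.
by rewrite mxE ComplexField.Normc.normc0.
Qed.

Lemma opnorm_le_mnorm (A : M) : opnorm A <= 2 * mnorm A.
Proof.
rewrite /opnorm; apply: ge_sup.
  exists (vnorm (A *m 0)); exists 0 => //=.
  by rewrite vnorm0 ler01.
by move=> _ [v v1 <-]; exact: vnorm_mulmx_le.
Qed.

Lemma opnorm_ge0 (A : M) : 0 <= opnorm A.
Proof.
apply: le_trans (vnorm_ge0 (A *m 0)) _; apply: ub_le_sup.
  by exists (2 * mnorm A) => _ [v v1 <-]; exact: vnorm_mulmx_le.
by exists 0 => //=; rewrite vnorm0 ler01.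
Qed.

Lemma normc_le_opnorm (A : M) a b : normc (A a b) <= opnorm A.
Proof.
pose e : 'cV[C]_d := delta_mx b 0.
have e1 : vnorm e <= 1.
  rewrite (le_trans (vnorm_le_sum _))// (bigD1 b)//= big1 ?addr0 => [|c cb].
    by rewrite mxE !eqxx ComplexField.Normc.normc1.
  by rewrite mxE (negbTE cb) ComplexField.Normc.normc0.
have -> : A a b = (A *m e) a 0 by rewrite -colE mxE.
apply: le_trans (normc_le_vnorm _ _) _; apply: ub_le_sup; last by exists e.
by exists (2 * mnorm A) => _ [v v1 <-]; exact: vnorm_mulmx_le.
Qed.

Lemma mnorm_le_opnorm (A : M) : mnorm A <= (2 * d * d)%:R * opnorm A.
Proof.
apply: (@le_trans _ _ (\sum_(a < d) \sum_(b < d) 2 * opnorm A)).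
  apply: ler_sum => a _; apply: ler_sum => b _.
  by apply: le_trans (cnorm_le_normc _) _; rewrite ler_wpM2l// normc_le_opnorm.
by rewrite !sumr_const !card_ord -mulrnA -[leLHS]mulr_natl mulrA -natrM mulnC mulnA.
Qed.

(* [F s = O(s ^ k)] as [s] tends to 0 from both sides. *)
Definition mxO (k : nat) (F : R -> M) : Prop := exists c : R,
  exists2 e : R, 0 < e & forall s, `|s| < e -> mnorm (F s) <= c * `|s| ^+ k.

Lemma mxO_ext k F G : F =1 G -> mxO k F -> mxO k G.
Proof. by move=> FG [c [e e0 h]]; exists c, e => // s /h; rewrite FG. Qed.

Lemma mxO_pos k F : mxO k F -> exists2 c : R, 0 <= c & exists2 e : R, 0 < e &
  forall s, `|s| < e -> mnorm (F s) <= c * `|s| ^+ k.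
Proof.
move=> [c [e e0 h]]; exists `|c| => //; exists e => // s /h /le_trans; apply.
by rewrite ler_wpM2r ?exprn_ge0// ler_norm.
Qed.

Lemma mxO0 k : mxO k (fun=> 0).
Proof. by exists 0, 1 => // s _; rewrite mnorm0 mul0r. Qed.

Lemma mxO_cst (A : M) : mxO 0 (fun=> A).
Proof. by exists (mnorm A), 1 => // s _; rewrite mulr1. Qed.

Lemma mxOD k F G : mxO k F -> mxO k G -> mxO k (fun s => F s + G s).
Proof.
move=> [c [e e0 hF]] [c' [e' e'0 hG]]; exists (c + c'), (Num.min e e').
  by rewrite lt_min e0.
move=> s; rewrite lt_min => /andP[/hF sF /hG sG].
by rewrite (le_trans (ler_mnormD _ _))// mulrDl lerD.
Qed.

Lemma mxON k F : mxO k F -> mxO k (fun s => - F s).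
Proof. by move=> [c [e e0 h]]; exists c, e => // s /h; rewrite mnormN. Qed.

Lemma mxOB k F G : mxO k F -> mxO k G -> mxO k (fun s => F s - G s).
Proof. by move=> hF /mxON; exact: mxOD. Qed.

Lemma mxO_sum k (I : Type) (r : seq I) (P : pred I) (F : I -> R -> M) :
  (forall i, P i -> mxO k (F i)) -> mxO k (fun s => \sum_(i <- r | P i) F i s).
Proof.
move=> hF; elim: r => [|x r IH].
  by apply: mxO_ext (mxO0 k) => s; rewrite big_nil.
case: (boolP (P x)) => Px.
  by apply: mxO_ext (mxOD (hF x Px) IH) => s; rewrite big_cons Px.
by apply: mxO_ext IH => s; rewrite big_cons (negbTE Px).
Qed.

Lemma mxOM k l F G : mxO k F -> mxO l G -> mxO (k + l) (fun s => F s * G s).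
Proof.
move=> /mxO_pos[c c0 [e e0 hF]] /mxO_pos[c' c'0 [e' e'0 hG]].
exists (c * c'), (Num.min e e'); first by rewrite lt_min e0.
move=> s; rewrite lt_min => /andP[/hF sF /hG sG].
rewrite (le_trans (ler_mnormM _ _))// exprD mulrACA.
by apply: ler_pM => //; exact: mnorm_ge0.
Qed.

Lemma mxO_le k l F : (l <= k)%N -> mxO k F -> mxO l F.
Proof.
move=> lk /mxO_pos[c c0 [e e0 hF]]; exists c, (Num.min e 1).
  by rewrite lt_min e0 ltr01.
move=> s; rewrite lt_min => /andP[/hF sF s1]; rewrite (le_trans sF)// ler_wpM2l//.
by rewrite ler_wiXn2l// ltW.
Qed.

Lemma mxOMl k (A : M) F : mxO k F -> mxO k (fun s => A * F s).
Proof. exact: (mxOM (mxO_cst A)). Qed.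

Lemma mxOZ k (c : C) F : mxO k F -> mxO k (fun s => c *: F s).
Proof.
by move=> /(mxOMl c%:M); apply: mxO_ext => s; rewrite -mul_scalar_mx.
Qed.

Lemma mxO_monomial k (A : M) : mxO k (fun s => (s ^+ k)%:C *: A).
Proof. by exists (mnorm A), 1 => // s _; rewrite mnorm_realZ normrX mulrC. Qed.

Lemma mxO_monomialM k l F : mxO l F -> mxO (k + l) (fun s => (s ^+ k)%:C *: F s).
Proof.
move=> [c [e e0 h]]; exists c, e => // s /h hs.
by rewrite mnorm_realZ normrX exprD mulrCA ler_wpM2l// exprn_ge0.
Qed.

(** Dividing by [|s| ^ k] bounds [mnorm A] by [c * |s|] with [s] arbitrarily small. *)
Lemma mxO_monomial_eq0 k (A : M) :
  mxO k.+1 (fun s => (s ^+ k)%:C *: A) -> A = 0.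
Proof.
move=> /mxO_pos[c c0 [e e0 h]].
suff A0 : mnorm A <= 0.
  apply/matrixP => a b; rewrite mxE; apply: (@ComplexField.Normc.eq0_normc R).
  apply/eqP; rewrite eq_le normc_ge0 andbT (le_trans (normc_le_cnorm _))//.
  exact: le_trans (ler_cnorm_mnorm _ _ _) A0.
apply/ler_addgt0Pr => y y0; rewrite add0r.
(* Within the radius [e] and with [c * s <= y]; [c + 1] replaces [c], which may be 0. *)
pose s := Num.min (e / 2) (y / (c + 1)).
have s0 : 0 < s by rewrite lt_min !divr_gt0// ltr_wpDl.
have se : `|s| < e.
  rewrite gtr0_norm// (@le_lt_trans _ _ (e / 2))//; first by rewrite ge_min lexx.
  by rewrite ltr_pdivrMr// ltr_pMr// ltr1n.
have := h _ se; rewrite mnorm_realZ normrX exprS mulrA [leRHS]mulrC.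
rewrite ler_pM2l ?exprn_gt0 ?normr_gt0 ?gt_eqF// => /le_trans; apply.
rewrite gtr0_norm// (@le_trans _ _ (c * (y / (c + 1))))//.
  by rewrite ler_wpM2l// ge_min lexx orbT.
have c1 : 0 < c + 1 by rewrite ltr_wpDl.
rewrite mulrCA; apply: ler_piMr; first exact: ltW.
by rewrite ler_pdivrMr// mul1r lerDl.
Qed.

(** The mean value theorem has no matrix-valued form, so it is applied to the two real parts of
    every entry; each part costs one [c]. *)
Lemma mxO_deriv k (F D : R -> M) : (forall s, is_dmx F s (D s)) -> mxO k D ->
  mxO k.+1 (fun s => F s - F 0).
Proof.
move=> dF /mxO_pos[c c0 [e e0 hD]].
have real_bound (f g : R -> R) : (forall s : R, is_derive s 1 f (g s)) ->
    (forall s, `|s| < e -> `|g s| <= c * `|s| ^+ k) ->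
    forall s, `|s| < e -> `|f s - f 0| <= c * `|s| ^+ k.+1.
  move=> df hg s se.
  have cf : continuous f.
    by move=> t; apply: differentiable_continuous; apply/derivable1_diffP.
  have [u us fs] : exists2 u, `|u| <= `|s| & `|f s - f 0| = `|g u| * `|s|.
    have [s0|s0] := leP 0 s.
      have [u] := MVT_segment s0 (fun x _ => df x) (continuous_subspaceT cf).
      rewrite in_itv/= => /andP[u0 us] ->; exists u; last by rewrite subr0 normrM.
      by rewrite !ger0_norm.
    have [u] := MVT_segment (ltW s0) (fun x _ => df x) (continuous_subspaceT cf).
    rewrite in_itv/= => /andP[su u0]; rewrite distrC => ->.
    exists u; last by rewrite sub0r normrM normrN.
    by rewrite (ler0_norm u0) (ltr0_norm s0) lerN2.
  rewrite fs exprSr mulrA ler_wpM2r// (le_trans (hg _ (le_lt_trans us se)))//.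
  by rewrite ler_wpM2l// lerXn2r ?nnegrE.
exists (\sum_(a < d) \sum_(b < d) (c + c)), e => // s se.
rewrite mulr_suml; apply: ler_sum => a _; rewrite mulr_suml; apply: ler_sum => b _.
have Db t : `|t| < e -> cnorm (D t a b) <= c * `|t| ^+ k.
  by move=> /hD; apply: le_trans; exact: ler_cnorm_mnorm.
rewrite !mxE /cnorm mulrDl ReD ImD lerD//.
- have := @real_bound (fun t => complex.Re (F t a b)) (fun t => complex.Re (D t a b)).
  move=> /(_ _ _ s se).
  rewrite (_ : complex.Re (- F 0 a b) = - complex.Re (F 0 a b)); last first.
    by case: (F 0 a b).
  apply=> [t|t te]; first by have [] := dF t a b.
  by apply: le_trans (Db t te); rewrite lerDl.
- have := @real_bound (fun t => complex.Im (F t a b)) (fun t => complex.Im (D t a b)).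
  move=> /(_ _ _ s se).
  rewrite (_ : complex.Im (- F 0 a b) = - complex.Im (F 0 a b)); last first.
    by case: (F 0 a b).
  apply=> [t|t te]; first by have [] := dF t a b.
  by apply: le_trans (Db t te); rewrite lerDr.
Qed.

Lemma is_dmx_mxO F (D : M) : is_dmx F 0 D -> mxO 0 F.
Proof.
move=> dF.
have real_bound (f : R -> R) : derivable f 0 1 ->
    exists2 e : R, 0 < e & forall s, `|s| < e -> `|f s| <= `|f 0| + 1.
  move=> df; have cf : {for 0, continuous f}.
    by apply: differentiable_continuous; apply/derivable1_diffP.
  have /cvgrPdist_le/(_ _ ltr01) := cf.
  move=> /nbhs_ballP[e /= e0 he]; exists e => // s se.
  have := he s; rewrite /ball/= sub0r normrN => /(_ se) h.
  by have := ler_normD (f 0) (f s - f 0); rewrite addrCA subrr addr0 distrC; lra.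
have /choice[c hc] : forall ab : 'I_d * 'I_d, exists ce : R * R, 0 < ce.2 /\
    forall s, `|s| < ce.2 -> cnorm (F s ab.1 ab.2) <= ce.1.
  move=> [a b]; have [d1 d2] := dF a b.
  have [e e0 he] := real_bound _ (ex_derive (is_derive := d1)).
  have [e' e'0 he'] := real_bound _ (ex_derive (is_derive := d2)).
  exists (`|complex.Re (F 0 a b)| + 1 + (`|complex.Im (F 0 a b)| + 1), Num.min e e').
  split; first by rewrite lt_min e0.
  by move=> s /=; rewrite lt_min => /andP[/he ? /he' ?]; exact: lerD.
(* Finitely many entries, hence a common radius; the default 1 covers [d = 0]. *)
exists (\sum_a \sum_b (c (a, b)).1), (\big[Num.min/1]_ab (c ab).2).
  by apply/bigmin_gtP; split => // ab _; have [] := hc ab.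
move=> s hs; rewrite expr0 mulr1; apply: ler_sum => a _; apply: ler_sum => b _.
have [_ /(_ s) /=] := hc (a, b); apply; apply: lt_le_trans hs _.
exact: bigmin_le_cond.
Qed.

End Norms.

(** * Matrix exponential *)

Section MatrixExponential.
Variable R : realType.
Local Notation C := R[i].
Variable d : nat.
Local Notation M := 'M[C]_d.
Implicit Types (A B X : M) (u v : nat -> M).

Lemma mulZmx (c : C) A B : (c *: A) * B = c *: (A * B).
Proof. exact: esym (scalemxAl _ _ _). Qed.

Lemma mulmxZ (c : C) A B : A * (c *: B) = c *: (A * B).
Proof. exact: esym (scalemxAr _ _ _). Qed.

Lemma adjM A B : (A * B)^t* = B^t* * A^t*.
Proof. by rewrite -[A * B]/(A *m B) trmx_mul map_mxM. Qed.

Lemma adjZ (c : C) A : (c *: A)^t* = Num.conj c *: A^t*.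
Proof. by rewrite linearZ /= map_mxZ. Qed.

Lemma adj1 : (1 : M)^t* = 1.
Proof. by rewrite -[1]/(1%:M) trmx1 map_mx1. Qed.

Lemma adj_sum (I : Type) (r : seq I) (P : pred I) (F : I -> M) :
  (\sum_(i <- r | P i) F i)^t* = \sum_(i <- r | P i) (F i)^t*.
Proof. by rewrite linear_sum /= map_mx_sum. Qed.

Lemma conj_real (x : R) : Num.conj (x%:C : C) = x%:C.
Proof. exact: conjc_real. Qed.

Lemma mnorm_adj A : mnorm (A^t*) = mnorm A.
Proof.
rewrite /mnorm exchange_big; apply: eq_bigr => a _; apply: eq_bigr => b _.
by rewrite !mxE [Num.conj _]/(conjc _); case: (A a b) => x y; rewrite /cnorm/= normrN.
Qed.

Lemma mxO_adj k (F : R -> M) : mxO k F -> mxO k (fun s => (F s)^t*).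
Proof. by move=> [c [e e0 h]]; exists c, e => // s /h; rewrite mnorm_adj. Qed.

Lemma cvg_sum (I : Type) (r : seq I) (f : I -> nat -> R) (l : I -> R) :
  (forall i, f i n @[n --> \oo] --> l i) ->
  \sum_(i <- r) f i n @[n --> \oo] --> \sum_(i <- r) l i.
Proof.
move=> fl; elim: r => [|i r IH].
  by rewrite big_nil; under eq_fun do rewrite big_nil; exact: cvg_cst.
by rewrite big_cons; under eq_fun do rewrite big_cons; exact: cvgD.
Qed.

Definition reim (b : bool) (z : C) : R := if b then complex.Re z else complex.Im z.

Lemma reim_sum b (I : Type) (r : seq I) (P : pred I) (F : I -> C) :
  reim b (\sum_(i <- r | P i) F i) = \sum_(i <- r | P i) reim b (F i).
Proof. by case: b => /=; rewrite ?Re_sum ?Im_sum. Qed.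

Lemma reim_real b (x : R) z : reim b (x%:C * z) = x * reim b z.
Proof. by case: b => /=; rewrite ?ReM ?ImM/= mul0r ?subr0 ?addr0. Qed.

Lemma norm_reim b z : `|reim b z| <= cnorm z.
Proof. by case: b => /=; rewrite /cnorm ?lerDl ?lerDr. Qed.

Definition mx_cvg u A := forall (a b : 'I_d) (r : bool),
  reim r (u n a b) @[n --> \oo] --> reim r (A a b).

Lemma mxlim_val u A : mx_cvg u A -> mxlim u = A.
Proof.
move=> uA; apply/matrixP => a b; rewrite /mxlim /entrywise mxE.
have /= h1 := cvg_lim (@Rhausdorff R) (uA a b true).
have /= h2 := cvg_lim (@Rhausdorff R) (uA a b false).
by rewrite h1 h2; case: (A a b).
Qed.

(** For fixed [z] this is a linear combination of the two parts of [w] with constant coefficients,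
    so convergence passes through a product. *)
Lemma reimM b z w : reim b (z * w) =
  complex.Re z * reim b w + (- 1) ^+ b * complex.Im z * reim (~~ b) w.
Proof. by case: b => /=; rewrite ?ReM ?ImM; ring. Qed.

Lemma mx_cvgMl B u A : mx_cvg u A -> mx_cvg (fun n => B * u n) (B * A).
Proof.
move=> uA a b r; rewrite mxME reim_sum.
under eq_fun do rewrite mxME reim_sum.
apply: cvg_sum => c; rewrite reimM.
under eq_fun do rewrite reimM.
by apply: cvgD; apply: cvgMl_tmp; exact: uA.
Qed.

Lemma mx_cvgMl_tmp B u A : mx_cvg u A -> mx_cvg (fun n => u n * B) (A * B).
Proof.
move=> uA a b r; rewrite mxME reim_sum.
under eq_fun do rewrite mxME reim_sum.
apply: cvg_sum => c; rewrite mulrC reimM.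
under eq_fun do rewrite mulrC reimM.
by apply: cvgD; apply: cvgMl_tmp; exact: uA.
Qed.

Lemma mx_cvg_conj u A : mx_cvg u A -> mx_cvg (fun n => (u n)^t*) (A^t*).
Proof.
move=> uA a b r; rewrite !mxE; under eq_fun do rewrite !mxE.
have E (z : C) : reim r (Num.conj z) = (- 1) ^+ (~~ r) * reim r z.
  rewrite [Num.conj z]/(conjc z); case: r; case: z => x y /=.
    by rewrite expr0 mul1r.
  by rewrite expr1 mulN1r.
rewrite E; under eq_fun do rewrite E.
by apply: cvgMl_tmp; exact: uA.
Qed.

(* Partial sums of the [j]-th derivative of [t |-> exp (t X)]. *)
Definition exp_partial (j : nat) X (t : R) (N : nat) : M :=
  \sum_(0 <= m < N) (m`!%:R^-1 * t ^+ m)%:C *: X ^+ (m + j).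

(** Real coefficients, to which termwise differentiation of power series applies; [pseries_diffs]
    raises [j] by one. *)
Definition exp_entry j X (a b : 'I_d) (r : bool) (m : nat) : R :=
  m`!%:R^-1 * reim r ((X ^+ (m + j)) a b).

(** Comparison with the scalar exponential series of [mnorm X * |t|]; [K] absorbs the [j] extra
    powers and the norm of the identity. *)
Lemma cvg_exp_entry j X a b r t : cvgn (pseries (exp_entry j X a b r) t).
Proof.
pose K := mnorm (1 : M) * mnorm X ^+ j.
apply: normed_cvg.
apply: (@series_le_cvg _ _ (fun m => K * exp_coeff (mnorm X * `|t|) m)).
- by move=> n; exact: normr_ge0.
- move=> n; rewrite mulr_ge0 ?mulr_ge0 ?exprn_ge0 ?mnorm_ge0//.
  by rewrite /exp_coeff/= mulr_ge0 ?exprn_ge0 ?mulr_ge0 ?mnorm_ge0.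
- move=> n; rewrite /exp_entry /exp_coeff /= !normrM normrX normfV normr_nat.
  have hX : `|reim r ((X ^+ (n + j)) a b)| <= mnorm (1 : M) * mnorm X ^+ (n + j).
    apply: le_trans (norm_reim _ _) _; apply: le_trans (ler_cnorm_mnorm _ _ _) _.
    exact: ler_mnormX.
  have n0 : 0 <= n`!%:R^-1 :> R by rewrite invr_ge0.
  apply: le_trans (ler_wpM2r (exprn_ge0 n (normr_ge0 t)) (ler_wpM2l n0 hX)) _.
  rewrite le_eqVlt; apply/orP; left; apply/eqP; rewrite exprD exprMn /K.
  move: (n`!%:R^-1) => y; ring.
- apply: is_cvg_seriesZ; exact: is_cvg_series_exp_coeff.
Qed.

Definition exp_deriv j X (t : R) : M := \matrix_(a, b)
  (limn (pseries (exp_entry j X a b true) t) +i*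
   limn (pseries (exp_entry j X a b false) t)).

Lemma exp_partial_cvg j X t : mx_cvg (exp_partial j X t) (exp_deriv j X t).
Proof.
move=> a b r.
have -> : reim r (exp_deriv j X t a b) = limn (pseries (exp_entry j X a b r) t).
  by rewrite mxE; case: r.
suff -> : (fun n => reim r (exp_partial j X t n a b)) = pseries (exp_entry j X a b r) t.
  exact: cvg_exp_entry.
apply/funext => n; rewrite /exp_partial summxE reim_sum; apply: eq_bigr => m _.
by rewrite mxE reim_real /exp_entry mulrAC.
Qed.

Lemma is_dmx_exp_deriv j X t : is_dmx (exp_deriv j X) t (exp_deriv j.+1 X t).
Proof.
have dE i a b r : pseries_diffs (exp_entry i X a b r) = exp_entry i.+1 X a b r.
  apply/funext => m; rewrite /pseries_diffs /exp_entry addSnnS factS natrM invfM.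
  by rewrite mulrA mulrA mulfV ?mul1r// pnatr_eq0.
move=> a b.
have h r : is_derive t 1 (fun x => limn (pseries (exp_entry j X a b r) x))
   (limn (pseries (exp_entry j.+1 X a b r) t)).
  (* Any radius beyond [|t|] works: the series and its first two formal derivatives converge
     everywhere. *)
  rewrite -dE; apply: (@pseries_snd_diffs _ _ (`|t| + 1)).
  - exact: cvg_exp_entry.
  - by rewrite dE; exact: cvg_exp_entry.
  - by rewrite !dE; exact: cvg_exp_entry.
  - by rewrite [ltRHS]ger0_norm ?addr_ge0// ltrDl.
rewrite mxE; split.
  by under eq_fun do rewrite mxE; exact: (h true).
by under eq_fun do rewrite mxE; exact: (h false).
Qed.

Lemma mxlimMl B u A : mx_cvg u A -> mxlim (fun n => B * u n) = B * A.
Proof. by move=> /(@mx_cvgMl B _ _)/mxlim_val. Qed.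

Lemma exp_derivS j X t : exp_deriv j.+1 X t = X * exp_deriv j X t.
Proof.
rewrite -(mxlim_val (@exp_partial_cvg j.+1 X t)).
rewrite -(@mxlimMl X _ _ (@exp_partial_cvg j X t)); congr mxlim.
apply/funext => n; rewrite /exp_partial mulr_sumr; apply: eq_bigr => m _.
by rewrite addnS exprS mulmxZ.
Qed.

(** With [exp_derivS] this shows that [X] commutes with its exponential. *)
Lemma exp_derivSr j X t : exp_deriv j.+1 X t = exp_deriv j X t * X.
Proof.
rewrite -(mxlim_val (@exp_partial_cvg j.+1 X t)).
rewrite -(mxlim_val (@mx_cvgMl_tmp X _ _ (@exp_partial_cvg j X t))); congr mxlim.
apply/funext => n; rewrite /exp_partial mulr_suml; apply: eq_bigr => m _.
by rewrite addnS exprSr mulZmx.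
Qed.

Lemma exprZmx (c : C) X m : (c *: X) ^+ m = c ^+ m *: X ^+ m.
Proof.
elim: m => [|m IH]; first by rewrite !expr0 scale1r.
by rewrite !exprS IH mulZmx mulmxZ scalerA.
Qed.

Lemma expmx_partial_cvg X t : mx_cvg
  (fun N => \sum_(0 <= m < N) (m`!)%:R^-1 *: (t%:C *: X) ^+ m) (exp_deriv 0 X t).
Proof.
rewrite (_ : (fun N => _) = exp_partial 0 X t); first exact: exp_partial_cvg.
apply/funext => N; apply: eq_bigr => m _.
rewrite addn0 exprZmx scalerA; congr (_ *: _).
by rewrite rmorphM rmorphXn fmorphV rmorph_nat.
Qed.

Lemma expmxE X t : expmx (t%:C *: X) = exp_deriv 0 X t.
Proof. exact/mxlim_val/expmx_partial_cvg. Qed.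

Definition flow X (t : R) : M := expmx (t%:C *: X).

Lemma is_dmx_flow X t : is_dmx (flow X) t (X * flow X t).
Proof.
rewrite (_ : flow X = exp_deriv 0 X); last by apply/funext => ?; exact: expmxE.
by rewrite -exp_derivS; exact: is_dmx_exp_deriv.
Qed.

Lemma flow0 X : flow X 0 = 1.
Proof.
rewrite /flow /expmx scale0r; apply: mxlim_val => a b r.
(* The partial sums are constant only from [n = 1] on; the empty one is 0. *)
apply: (@cvg_near_cst _ _ _ _ _ _); near=> n.
have n0 : (0 < n)%N by near: n; exists 1%N.
rewrite big_ltn// expr0 fact0 invr1 scale1r big_nat big1 ?addr0// => m /andP[m0 _].
by rewrite expr0n (gtn_eqF m0) scaler0.
Unshelve. all: by end_near. Qed.

Lemma mxO_flow_sub1 X : mxO 1 (fun s => flow X s - 1).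
Proof.
apply: (mxO_ext (F := fun s => flow X s - flow X 0)) => [s|]; first by rewrite flow0.
apply: mxO_deriv (is_dmx_flow X) _; apply: mxOMl.
exact: is_dmx_mxO (is_dmx_flow X 0).
Qed.

(** The product has zero derivative and value 1 at 0, so no Cauchy product of series is needed. *)
Lemma flowNK X t : flow (- X) t * flow X t = 1.
Proof.
suff d0 s : is_dmx (fun t => flow (- X) t * flow X t) s 0.
  by rewrite (is_dmx_cst_eq _ d0) !flow0 mulr1.
apply: is_dmx_eq (is_dmxM (is_dmx_flow (- X) s) (is_dmx_flow X s)) _.
have -> : - X * flow (- X) s = flow (- X) s * - X.
  by rewrite /flow !expmxE -exp_derivS exp_derivSr.
by rewrite mulrN mulNr mulrA addNr.
Qed.

Lemma flow_comm X t : flow X t * X = X * flow X t.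
Proof. by rewrite /flow !expmxE -exp_derivS exp_derivSr. Qed.

Lemma flow_adj X t : X^t* = - X -> (flow X t)^t* = flow (- X) t.
Proof.
move=> XN; rewrite {1}/flow expmxE.
rewrite -(mxlim_val (@mx_cvg_conj _ _ (@expmx_partial_cvg X t))); congr mxlim.
apply/funext => N; rewrite adj_sum; apply: eq_bigr => m _.
rewrite adjZ fmorphV rmorph_nat; congr (_ *: _).
elim: m => [|m IH]; first by rewrite !expr0 adj1.
by rewrite exprS exprSr adjM IH adjZ conj_real XN.
Qed.

End MatrixExponential.

(** * Taylor expansion of a conjugation *)

Section Conjugation.
Variables (R : realType) (d : nat).
Local Notation C := R[i].
Local Notation M := 'M[C]_d.
Implicit Types (P X Y Z : M) (s : R).

Definition conjby P Y : M := P * Y * P^t*.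

Lemma conjbyM P Q Y : conjby (P * Q) Y = conjby P (conjby Q Y).
Proof. by rewrite /conjby adjM !mulrA. Qed.

Lemma conjby1 Y : conjby 1 Y = Y.
Proof. by rewrite /conjby adj1 mul1r mulr1. Qed.

Lemma conjbyZ P (c : C) Y : conjby P (c *: Y) = c *: conjby P Y.
Proof. by rewrite /conjby mulmxZ mulZmx. Qed.

Lemma conjbyB P Y Z : conjby P (Y - Z) = conjby P Y - conjby P Z.
Proof. by rewrite /conjby mulrBr mulrBl. Qed.

Lemma conjby_sum P (I : Type) (r : seq I) (Q : pred I) (F : I -> M) :
  conjby P (\sum_(i <- r | Q i) F i) = \sum_(i <- r | Q i) conjby P (F i).
Proof. by rewrite /conjby mulr_sumr mulr_suml. Qed.

Section AntiHermitian.
Variable X : M.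
Hypothesis XN : X^t* = - X.

Lemma flow_unitary s : flow X s * (flow X s)^t* = 1.
Proof. by rewrite flow_adj// -[X in flow X s](opprK X) flowNK. Qed.

Lemma flow_unitaryV s : (flow X s)^t* * flow X s = 1.
Proof. by rewrite flow_adj// flowNK. Qed.

(** The adjoint flow is [flow (- X)], and since [X] commutes with its flow both terms of the product
    rule move inside the conjugation. *)
Lemma is_dmx_conj_flow Y s : is_dmx (fun t => conjby (flow X t) Y) s
  (conjby (flow X s) (ad X Y)).
Proof.
rewrite (_ : (fun t => _) = fun t => flow X t * Y * flow (- X) t); last first.
  by apply/funext => t; rewrite /conjby flow_adj.
apply: is_dmx_eq (is_dmxM (is_dmxMr Y (is_dmx_flow X s)) (is_dmx_flow (- X) s)) _.
rewrite /conjby flow_adj// /ad mulrBr mulrBl -flow_comm !mulrA.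
by rewrite mulrN mulNr.
Qed.

(** Used for the continuity of integrands, so the value of the derivative is left open. *)
Lemma ex_derive_power_scale m (c e s x : R) :
  exists df : R, is_derive x 1 (fun t => (s - t) ^+ m * c / e) df.
Proof.
have ds : is_derive x 1 (fun t => s - t) (-1).
  have := is_deriveB (is_derive_cst s x 1) (is_derive_id x 1); rewrite sub0r; exact.
exists ((c / e) *: 'D_1 ((fun t => s - t) ^+ m) x).
have -> : (fun t => (s - t) ^+ m * c / e) = (c / e) *: (fun t => s - t) ^+ m.
  by apply/funext => t; rewrite -[LHS]mulrA mulrC exprfctE.
apply: is_deriveZ; apply/derivableP; apply: derivableX.
exact: ex_derive.
Qed.

Definition taylor_sum (Y : M) (m : nat) s : M :=
  \sum_(0 <= t < m) (s ^+ t / t`!%:R)%:C *: iter t (ad X) Y.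

Lemma is_derive_divided_power m (f : R -> R) (x df : R) : is_derive x 1 f df ->
  is_derive x 1 (fun t => f t ^+ m.+1 / (m.+1)`!%:R) (df * (f x ^+ m / m`!%:R)).
Proof.
move=> fx.
rewrite (_ : (fun t => _) = (m.+1)`!%:R^-1 *: f ^+ m.+1); last first.
  by apply/funext => t; rewrite mulrC exprfctE.
apply: is_derive_eq.
rewrite factS natrM invfM /GRing.scale/= -mulr_natl.
have : m.+1%:R != 0 :> R by rewrite pnatr_eq0.
by move: (m.+1%:R : R) (m`!%:R^-1 : R) => z y z0; field.
Qed.

Lemma taylor_sum0 Y m : taylor_sum Y m.+1 0 = Y.
Proof.
rewrite /taylor_sum big_nat_recl//= big1 => [|t _].
  by rewrite expr0 fact0 divr1 scale1r addr0.
by rewrite exprS !mul0r scale0r.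
Qed.

(** The remainder of order [m.+1] for [Y] vanishes at 0 and has as derivative the remainder of order
    [m] for [ad X Y]; integrating gains one order. *)
Lemma conj_flow_taylor_mxO m Y :
  mxO m (fun s => conjby (flow X s) Y - taylor_sum Y m s).
Proof.
elim: m Y => [|m IH] Y.
  apply: (mxO_ext (F := fun s => conjby (flow X s) Y)) => [s|].
    by rewrite /taylor_sum big_geq// subr0.
  exact: is_dmx_mxO (is_dmx_conj_flow _ _).
have := @mxO_deriv _ _ m (fun s => conjby (flow X s) Y - taylor_sum Y m.+1 s)
  (fun s => conjby (flow X s) (ad X Y) - taylor_sum (ad X Y) m s).
move=> /(_ _ (IH _)) h.
apply: (mxO_ext (F := fun s => conjby (flow X s) Y - taylor_sum Y m.+1 s
   - (conjby (flow X 0) Y - taylor_sum Y m.+1 0))) => [s|].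
  by rewrite flow0 conjby1 taylor_sum0 subrr subr0.
apply: h => s; apply: is_dmxB; first exact: is_dmx_conj_flow.
(* With the constant term set apart, every other term is a divided power that differentiates to the
   preceding one. *)
have E : taylor_sum Y m.+1 = fun t => Y +
    \sum_(0 <= i < m) (t ^+ i.+1 / i.+1`!%:R)%:C *: iter i (ad X) (ad X Y).
  apply/funext => t; rewrite /taylor_sum big_nat_recl//= expr0 fact0 divr1 scale1r.
  by congr (_ + _); apply: eq_bigr => i _; rewrite -iterSr.
rewrite E -[taylor_sum _ _ _]add0r; apply: is_dmxD; first exact: is_dmx_cst.
apply: is_dmx_sum => i _.
have dp := is_derive_divided_power i (is_derive_id s 1).
apply: is_dmx_eq (is_dmxZ dp (is_dmx_cst _ _)) _.
by rewrite scaler0 addr0 mul1r.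
Qed.

(** Taylor's formula with integral remainder, under the outer factors [P] not yet expanded and with
    the scalar [c] left by the inner factors already expanded. *)
Lemma mxint_conj_flow (c : R) P Y m s : 0 <= s ->
  mxint 0 s (fun sigma => ((s - sigma) ^+ m * c / m`!%:R)%:C *:
     conjby (P * flow X sigma) (iter m.+1 (ad X) Y))
  = c%:C *: conjby P (conjby (flow X s) Y - taylor_sum Y m.+1 s).
Proof.
move=> s0.
pose Phi t sigma := conjby (P * flow X sigma) (iter t (ad X) Y).
have dPhi t sigma : is_dmx (Phi t) sigma (Phi t.+1 sigma).
  rewrite /Phi; under eq_fun do rewrite conjbyM; rewrite conjbyM.
  by apply: is_dmxMr; apply: is_dmxMl; exact: is_dmx_conj_flow.
(* The derivative of [T n.+1] telescopes to its last term. *)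
pose T n sigma := \sum_(0 <= t < n) ((s - sigma) ^+ t / t`!%:R)%:C *: Phi t sigma.
have ds (x : R) : is_derive x 1 (fun t => s - t) (-1).
  have := is_deriveB (is_derive_cst s x 1) (is_derive_id x 1); rewrite sub0r; exact.
have dT n x : is_dmx (T n.+1) x (((s - x) ^+ n / n`!%:R)%:C *: Phi n.+1 x).
  elim: n => [|n IH].
    rewrite expr0 fact0 divr1 scale1r (_ : T 1 = Phi 0); first exact: dPhi.
    by apply/funext => t; rewrite /T big_nat1 expr0 fact0 divr1 scale1r.
  rewrite (_ : T n.+2 = fun t => T n.+1 t +
      ((s - t) ^+ n.+1 / (n.+1)`!%:R)%:C *: Phi n.+1 t); last first.
    by apply/funext => t; rewrite /T big_nat_recr.
  have dp := is_derive_divided_power n (ds x).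
  apply: is_dmx_eq (is_dmxD IH (is_dmxZ dp (dPhi n.+1 x))) _.
  by rewrite mulN1r rmorphN scaleNr addrA subrr add0r.
rewrite (@mxint_FTC _ _ (fun x => c%:C *: T m.+1 x)) //.
(* At [sigma = s] only the term [t = 0] survives; [sigma = 0] gives the Taylor polynomial. *)
- rewrite -scalerBr; congr (_ *: _).
  rewrite {1}/T big_nat_recl//= big1 => [|t _]; last first.
    by rewrite subrr exprS !mul0r scale0r.
  rewrite expr0 fact0 divr1 scale1r addr0 /Phi/= conjbyM conjbyB; congr (_ - _).
  rewrite conjby_sum; apply: eq_bigr => t _.
  by rewrite subr0 /Phi flow0 mulr1 conjbyZ.
- move=> t; apply: is_dmx_eq (is_dmxZl _ (dT m t)) _.
  by rewrite scalerA -rmorphM mulrCA mulrA.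
- move=> t.
  have [df h] := ex_derive_power_scale m c m`!%:R s t.
  by eexists; apply: is_dmxZ h (dPhi _ _).
Qed.

End AntiHermitian.
End Conjugation.

(** * Multi-index expansion of a product of conjugations *)

Section MultiIndexExpansion.
Variables (R : realType) (d U k : nat).
Local Notation C := R[i].
Local Notation M := 'M[C]_d.
Variable Xs : 'I_U -> M.
Hypothesis XsN : forall m, (Xs m)^t* = - Xs m.
Implicit Types (p n : nat) (m : 'I_U) (q : {ffun 'I_U -> 'I_k.+1}) (s : R) (Y : M).

Definition flow_prefix p s : M := \prod_(m < U | (m < p)%N) flow (Xs m) s.

Lemma flow_prefix0 s : flow_prefix 0 s = 1.
Proof. exact: big_pred0. Qed.

Lemma flow_prefixS m s : flow_prefix m.+1 s = flow_prefix m s * flow (Xs m) s.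
Proof.
(* The factors do not commute, so the last one is split off in a product over naturals; 1 is a
   default beyond [U]. *)
pose f i := if insub i is Some i' then flow (Xs i') s else 1.
have fE (i : 'I_U) : f i = flow (Xs i) s by rewrite /f valK.
have E p : (p <= U)%N -> flow_prefix p s = \prod_(0 <= i < p) f i.
  move=> pU; rewrite (big_nat_widen _ _ _ _ _ pU) big_mkord.
  by apply: eq_bigr => i _; rewrite fE.
rewrite (E _ (ltn_ord m)) (E _ (ltnW (ltn_ord m))) big_nat_recr//=.
by rewrite fE.
Qed.

(** The bound may be [U] itself, while the step receives an ordinal so that [Xs m] makes sense. *)
Lemma flow_prefix_ind (P : nat -> Prop) :
  P 0 -> (forall m, P m -> P m.+1) -> forall p, (p <= U)%N -> P p.
Proof.
move=> P0 PS; elim=> // p IH pU.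
exact: (PS (Ordinal pU)) (IH (ltnW pU)).
Qed.

Lemma flow_prefix_unitaryV p s : (p <= U)%N ->
  (flow_prefix p s)^t* * flow_prefix p s = 1.
Proof.
move: p; apply: flow_prefix_ind => [|m IH]; first by rewrite flow_prefix0 adj1 mulr1.
rewrite flow_prefixS adjM -mulrA [X in _ * X = _]mulrA IH mul1r.
exact: flow_unitaryV.
Qed.

(** Only the logarithmic derivative has a tidy form: every factor to the right of the differentiated
    one cancels against its adjoint. *)
Lemma is_dmx_flow_prefix p s : (p <= U)%N -> exists2 D,
  is_dmx (flow_prefix p) s D & D * (flow_prefix p s)^t* =
    \sum_(m < U | (m < p)%N) conjby (flow_prefix m s) (Xs m).
Proof.
move: p; apply: flow_prefix_ind => [|m [D dD DE]].
  exists 0; last by rewrite mul0r big_pred0.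
  rewrite (_ : flow_prefix 0 = fun=> 1); first exact: is_dmx_cst.
  by apply/funext => t; rewrite flow_prefix0.
exists (D * flow (Xs m) s + flow_prefix m s * (Xs m * flow (Xs m) s)).
  rewrite (_ : flow_prefix m.+1 = fun t => flow_prefix m t * flow (Xs m) t).
    by apply: is_dmxM dD _; exact: is_dmx_flow.
  by apply/funext => t; rewrite flow_prefixS.
rewrite flow_prefixS adjM mulrDl.
rewrite -[X in X + _]mulrA [X in D * X]mulrA flow_unitary// mul1r DE.
rewrite -!mulrA [X in Xs m * X]mulrA flow_unitary// mul1r.
rewrite [RHS](bigD1 m)//= [LHS]addrC; congr (_ + _); first by rewrite /conjby -?mulrA.
by apply: eq_bigl => i; rewrite ltnS andbC -ltn_neqAle.
Qed.

Definition midx_upd q m (t : 'I_k.+1) : {ffun 'I_U -> 'I_k.+1} :=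
  [ffun i => if i == m then t else q i].

(** The window is a parameter here and below because the expansion lowers [p] one factor at a
    time. *)
Definition midx_wt p n q : nat := (\sum_(i < U | p <= i < n) q i)%N.

Definition midx_fact p n q : nat := (\prod_(i < U | p <= i < n) (q i)`!)%N.

Definition midx_ad p n q Y : M :=
  foldr (fun i Z => iter (q i) (ad (Xs i)) Z) Y
    [seq i : 'I_U <- enum 'I_U | p <= i < n]%N.

Definition midx_supp p n q : bool :=
  [forall i : 'I_U, ~~ (p <= i < n)%N ==> (q i == 0 :> nat)%N].

Lemma itv_neqE m n (i : 'I_U) :
  (m <= i < n)%N && (i != m) = (m < i < n)%N.
Proof. by rewrite andbAC; congr (_ && _); rewrite ltn_neqAle andbC eq_sym. Qed.

Lemma midx_wt_upd q m n t : (m < n)%N ->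
  midx_wt m n (midx_upd q m t) = (t + midx_wt m.+1 n q)%N.
Proof.
move=> mn; rewrite /midx_wt (bigD1 m) ?leqnn//= ffunE eqxx; congr (_ + _)%N.
apply: eq_big => [i|i /andP[_ /negbTE im]]; last by rewrite ffunE im.
exact: itv_neqE.
Qed.

Lemma midx_fact_upd q m n t : (m < n)%N ->
  midx_fact m n (midx_upd q m t) = (t`! * midx_fact m.+1 n q)%N.
Proof.
move=> mn; rewrite /midx_fact (bigD1 m) ?leqnn//= ffunE eqxx; congr (_ * _)%N.
apply: eq_big => [i|i /andP[_ /negbTE im]]; last by rewrite ffunE im.
exact: itv_neqE.
Qed.

(** Two strictly increasing lists with the same members are equal. *)
Lemma filter_enum_ord_itv m n : (m < n)%N ->
  [seq i : 'I_U <- enum 'I_U | m <= i < n]%N =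
  m :: [seq i : 'I_U <- enum 'I_U | m < i < n]%N.
Proof.
move=> mn; pose lt := [rel i j : 'I_U | (i < j)%N].
have ltT : transitive lt by move=> x y z; exact: ltn_trans.
have sE : sorted lt (enum 'I_U).
  by have := iota_ltn_sorted 0 U; rewrite -val_enum_ord sorted_map.
apply: (@irr_sorted_eq _ lt) => //.
- by move=> x; rewrite /lt/= ltnn.
- exact: sorted_filter.
- rewrite /= path_sortedE//; apply/andP; split; last exact: sorted_filter.
  by apply/allP => x; rewrite mem_filter => /andP[/andP[]].
- move=> x; have fE (Q : pred 'I_U) : (x \in [seq i <- enum 'I_U | Q i]) = Q x.
    by rewrite mem_filter mem_enum andbT.
  rewrite in_cons !fE -itv_neqE.
  by case: eqP => [->|]; rewrite ?leqnn ?mn ?andbT.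
Qed.

Lemma midx_ad_upd q m n t Y : (m < n)%N ->
  midx_ad m n (midx_upd q m t) Y = iter t (ad (Xs m)) (midx_ad m.+1 n q Y).
Proof.
move=> mn; rewrite /midx_ad filter_enum_ord_itv//= ffunE eqxx.
congr (iter _ _ _).
have : m \notin [seq i : 'I_U <- enum 'I_U | m < i < n]%N by rewrite mem_filter ltnn.
elim: [seq _ <- _ | _] => //= i r IH; rewrite inE negb_or => /andP[mi /IH ->].
by rewrite ffunE eq_sym (negbTE mi).
Qed.

Lemma midx_suppS q m n : (m < n)%N ->
  midx_supp m.+1 n q = midx_supp m n q && (q m == ord0).
Proof.
move=> mn; apply/forallP/andP => [sq|[/forallP sq qm] i].
  split; last by have := sq m; rewrite ltnn.
  apply/forallP => i; apply/implyP => hi; apply: (implyP (sq i)).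
  by rewrite -itv_neqE negb_and hi.
apply/implyP; rewrite -itv_neqE negb_and => /orP[|]; first exact/implyP.
by rewrite negbK => /eqP ->.
Qed.

(** A multi-index on the window from [m] amounts to its entry at [m] and a multi-index past [m]; the
    inverse resets that entry to 0. *)
Lemma sum_midx_upd (V : zmodType) (Q : pred {ffun 'I_U -> 'I_k.+1}) (F : _ -> V) m n :
  (m < n)%N -> \sum_(q | midx_supp m n q && Q q) F q =
  \sum_(q | midx_supp m.+1 n q)
    \sum_(t : 'I_k.+1 | Q (midx_upd q m t)) F (midx_upd q m t).
Proof.
move=> mn; rewrite pair_big_dep /=.
rewrite (reindex_onto (fun x : {ffun 'I_U -> 'I_k.+1} * 'I_k.+1 => midx_upd x.1 m x.2)
  (fun q => (midx_upd q m ord0, q m))) /=; last first.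
  move=> q _; apply/ffunP => i; rewrite !ffunE; by case: eqP => [->|].
apply: eq_bigl => -[q t] /=; rewrite xpair_eqE.
have -> : midx_upd q m t m = t by rewrite ffunE eqxx.
rewrite eqxx andbT.
have E : (midx_upd (midx_upd q m t) m ord0 == q) = (q m == ord0).
  apply/eqP/eqP => [<-|qm]; first by rewrite ffunE eqxx.
  by apply/ffunP => i; rewrite !ffunE; case: eqP => [->|].
rewrite E andbAC; congr (_ && _); rewrite midx_suppS//.
case: eqP => [qm|]; rewrite ?andbF// !andbT.
apply/forallP/forallP => sq i; have := sq i; rewrite ffunE.
  by case: (i =P m) => [->|//]; rewrite leqnn mn.
by case: (i =P m) => [->|//]; rewrite leqnn mn.
Qed.

Lemma midx_supp_nn n q : midx_supp n n q = (q == [ffun=> ord0]).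
Proof.
apply/forallP/eqP => [sq|-> i]; last by rewrite ffunE implybT.
apply/ffunP => i; rewrite ffunE; apply/val_inj/eqP; apply: (implyP (sq i)).
by rewrite ltnNge; case: leqP.
Qed.

(* The terms of degree below [k] once the factors [p, ..., n - 1] are expanded. *)
Definition midx_sum p n Y s : M :=
  \sum_(q | midx_supp p n q && (midx_wt p n q < k)%N)
    (s ^+ midx_wt p n q / (midx_fact p n q)%:R)%:C *:
      conjby (flow_prefix p s) (midx_ad p n q Y).

(** On an empty window only the zero multi-index remains; its weight 0 is below [k] because
    [0 < k]. *)
Lemma midx_sum_top n Y s : (0 < k)%N ->
  midx_sum n n Y s = conjby (flow_prefix n s) Y.
Proof.
move=> k0; have nn (i : 'I_U) : (n <= i < n)%N = false.
  by rewrite ltnNge; case: leqP.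
have wt0 q : midx_wt n n q = 0%N by rewrite /midx_wt big_pred0.
rewrite /midx_sum (big_pred1 [ffun=> ord0]) => [|q]; last first.
  by rewrite wt0 k0 andbT midx_supp_nn.
rewrite wt0 expr0 /midx_fact big_pred0// divr1 scale1r /midx_ad.
by rewrite (eq_filter (a2 := pred0)) ?filter_pred0.
Qed.

(** For weight [w] past [m], the entry [t] at [m] keeps the total below [k] exactly when
    [t < k - w], which groups the terms into a Taylor polynomial of that length. *)
Lemma midx_sum_step m n Y s : (m < n)%N ->
  midx_sum m.+1 n Y s - midx_sum m n Y s =
  \sum_(q | midx_supp m.+1 n q && (midx_wt m.+1 n q < k)%N)
    (s ^+ midx_wt m.+1 n q / (midx_fact m.+1 n q)%:R)%:C *:
      conjby (flow_prefix m s)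
        (conjby (flow (Xs m) s) (midx_ad m.+1 n q Y)
         - taylor_sum (Xs m) (midx_ad m.+1 n q Y) (k - midx_wt m.+1 n q) s).
Proof.
move=> mn; rewrite /midx_sum (sum_midx_upd _ _ mn).
rewrite [X in _ - X](bigID (fun q => midx_wt m.+1 n q < k)%N) /=.
rewrite [X in _ - (_ + X)]big1 ?addr0 => [|q /andP[_ kw]]; last first.
  rewrite big_pred0// => t; apply/negbTE; rewrite -leqNgt midx_wt_upd//.
  by rewrite -leqNgt in kw; rewrite (leq_trans kw)// leq_addl.
rewrite -sumrB; apply: eq_bigr => q /andP[_ qk].
rewrite conjbyB scalerBr flow_prefixS conjbyM; congr (_ - _).
rewrite conjby_sum scaler_sumr.
set w := midx_wt m.+1 n q in qk *.
rewrite (eq_bigl (fun t : 'I_k.+1 => t < k - w)%N); last first.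
  by move=> t; rewrite midx_wt_upd// ltn_subRL addnC.
have kw : (k - w <= k.+1)%N by rewrite (leq_trans (leq_subr _ _)).
rewrite (big_nat_widen _ _ _ _ _ kw) big_mkord.
apply: eq_bigr => t _; rewrite conjbyZ scalerA -rmorphM.
rewrite (midx_wt_upd _ _ mn) (midx_fact_upd _ _ mn) (midx_ad_upd _ _ _ mn).
apply: (congr1 (fun z : R => z%:C *: _)).
by rewrite exprD natrM invfM; ring.
Qed.

Definition midx_kernel m n q s sigma : R :=
  (s - sigma) ^+ (q m).-1 * s ^+ midx_wt m.+1 n q
    / ((q m).-1`! * midx_fact m.+1 n q)%N%:R.

(** Positive entry at [m] and total weight [k] mean weight [w < k] past [m] and entry exactly
    [k - w]: one multi-index for each Taylor remainder. *)
Lemma midx_sum_step_mxint m n Y s : (m < n)%N -> 0 <= s ->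
  midx_sum m.+1 n Y s - midx_sum m n Y s =
  \sum_(q | midx_supp m n q && ((0 < q m)%N && (midx_wt m n q == k)))
    mxint 0 s (fun sigma => (midx_kernel m n q s sigma)%:C *:
      conjby (flow_prefix m s * flow (Xs m) sigma) (midx_ad m n q Y)).
Proof.
move=> mn s0; rewrite midx_sum_step// (sum_midx_upd _ _ mn).
rewrite [RHS](bigID (fun q => midx_wt m.+1 n q < k)%N) /=.
rewrite [X in _ = _ + X]big1 ?addr0 => [|q /andP[_ kw]]; last first.
  rewrite big_pred0// => t; rewrite midx_wt_upd// ffunE eqxx.
  rewrite -leqNgt in kw; case: (posnP t) => //= t0; apply/negbTE.
  by rewrite gtn_eqF// (leq_ltn_trans kw)// -[ltnLHS]add0n ltn_add2r.
apply: eq_bigr => q /andP[_ qk]; set w := midx_wt m.+1 n q in qk *.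
have kwk : (k - w < k.+1)%N by rewrite ltnS leq_subr.
rewrite (big_pred1 (Ordinal kwk)) => [|t]; last first.
  rewrite midx_wt_upd// ffunE eqxx -/w /=.
  apply/andP/eqP => [[_ /eqP tk]|->].
    by apply: val_inj; rewrite /= -[X in (X - w)%N]tk addnK.
  by rewrite /= subn_gt0 qk subnK// ltnW.
rewrite midx_ad_upd//= /midx_kernel ffunE eqxx /=.
have -> : midx_wt m.+1 n (midx_upd q m (Ordinal kwk)) = w.
  apply: eq_bigr => i /andP[mi _]; rewrite ffunE; case: eqP => // im.
  by rewrite im ltnn in mi.
have -> : midx_fact m.+1 n (midx_upd q m (Ordinal kwk)) = midx_fact m.+1 n q.
  apply: eq_bigr => i /andP[mi _]; rewrite ffunE; case: eqP => // im.
  by rewrite im ltnn in mi.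
(* The remainder of order [r.+1] has kernel exponent [r], the predecessor in [midx_kernel]. *)
case E : (k - w)%N => [|r]; first by move: qk; rewrite -subn_gt0 E.
rewrite -(mxint_conj_flow (XsN m) _ _ _ _ s0) /=; congr mxint.
apply/funext => sigma; congr (_%:C *: _).
by rewrite natrM invfM; ring.
Qed.

(** The factor [s ^ w] meets a remainder of order [k - w], between outer factors that are bounded
    near 0. *)
Lemma mxO_midx_sum_step m n Y : (m < n)%N ->
  mxO k (fun s => midx_sum m.+1 n Y s - midx_sum m n Y s).
Proof.
move=> mn; apply: (mxO_ext (fun s => esym (midx_sum_step Y s mn))).
apply: mxO_sum => q /andP[_ qk]; set w := midx_wt m.+1 n q in qk *.
rewrite -[k in mxO k _](subnKC (ltnW qk)).
pose f := (midx_fact m.+1 n q)%:R^-1 : R.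
pose F s := conjby (flow (Xs m) s) (midx_ad m.+1 n q Y)
  - taylor_sum (Xs m) (midx_ad m.+1 n q Y) (k - w) s.
have hF : mxO (k - w) F by exact: conj_flow_taylor_mxO.
apply: (mxO_ext (F := fun s =>
  (s ^+ w)%:C *: (f%:C *: conjby (flow_prefix m s) (F s)))).
  by move=> s; rewrite scalerA -rmorphM.
apply: mxO_monomialM; apply: mxOZ.
have [D dD _] := is_dmx_flow_prefix 0 (ltnW (ltn_ord m)).
have P0 : mxO 0 (flow_prefix m) := is_dmx_mxO dD.
by have := mxOM (mxOM P0 hF) (mxO_adj P0); rewrite add0n addn0.
Qed.

(** The step index [m] becomes the component [i] of the multi-index, the lowest position with a
    positive exponent. *)
Lemma midx_sum_telescope n Y s : (n <= U)%N -> (0 < k)%N -> 0 <= s ->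
  conjby (flow_prefix n s) Y - midx_sum 0 n Y s =
  \sum_(m < U | (m < n)%N)
    \sum_(q | midx_supp m n q && ((0 < q m)%N && (midx_wt m n q == k)))
    mxint 0 s (fun sigma => (midx_kernel m n q s sigma)%:C *:
      conjby (flow_prefix m s * flow (Xs m) sigma) (midx_ad m n q Y)).
Proof.
move=> nU k0 s0; rewrite -(midx_sum_top n Y s k0).
suff h p : (p <= U)%N -> (p <= n)%N -> midx_sum p n Y s - midx_sum 0 n Y s =
  \sum_(m < U | (m < p)%N)
    \sum_(q | midx_supp m n q && ((0 < q m)%N && (midx_wt m n q == k)))
    mxint 0 s (fun sigma => (midx_kernel m n q s sigma)%:C *:
      conjby (flow_prefix m s * flow (Xs m) sigma) (midx_ad m n q Y)).
  exact: h.
move: p; apply: flow_prefix_ind => [_|m IH mn]; first by rewrite subrr big_pred0.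
rewrite [RHS](bigD1 m (ltnSn m)).
rewrite -[X in _ = X + _](midx_sum_step_mxint Y mn s0).
rewrite -[LHS](subrKA (midx_sum m n Y s)).
rewrite [X in _ + X](IH (ltnW mn)).
apply: (congr1 (fun Z => _ + Z)).
apply: eq_bigl => i.
by rewrite ltnS andbC -ltn_neqAle.
Qed.

Lemma mxO_midx_sum_telescope n Y : (n <= U)%N -> (0 < k)%N ->
  mxO k (fun s => conjby (flow_prefix n s) Y - midx_sum 0 n Y s).
Proof.
move=> nU k0.
suff h p : (p <= U)%N -> (p <= n)%N ->
    mxO k (fun s => midx_sum p n Y s - midx_sum 0 n Y s).
  by apply: mxO_ext (h n nU (leqnn n)) => s; rewrite midx_sum_top.
move: p; apply: flow_prefix_ind => [_|m IH mn].
  by apply: mxO_ext (mxO0 _ _ _) => s; rewrite subrr.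
apply: mxO_ext (mxOD (mxO_midx_sum_step Y mn) (IH (ltnW mn))) => s.
by rewrite subrKA.
Qed.

Definition midx_coef n Y (p : nat) : M :=
  \sum_(q | midx_supp 0 n q && (midx_wt 0 n q == p))
    ((midx_fact 0 n q)%:R^-1)%:C *: midx_ad 0 n q Y.

Lemma midx_sum_poly n Y s :
  midx_sum 0 n Y s = \sum_(p < k) (s ^+ p)%:C *: midx_coef n Y p.
Proof.
(* All weights in this sum are below [k], so [inord] preserves them. *)
rewrite /midx_sum (partition_big (fun q => inord (midx_wt 0 n q) : 'I_k.+1)
  (fun p : 'I_k.+1 => p < k)%N) /=; last first.
  by move=> q /andP[_ qk]; rewrite inordK// ltnW.
have -> : \sum_(p < k) (s ^+ p)%:C *: midx_coef n Y p =
    \sum_(p < k.+1 | (p < k)%N) (s ^+ p)%:C *: midx_coef n Y p.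
  exact: (big_ord_widen _ (fun p => (s ^+ p)%:C *: midx_coef n Y p) (leqnSn k)).
apply: eq_bigr => p pk; rewrite scaler_sumr; apply: eq_big => [q|q].
  rewrite -andbA; congr (_ && _).
  apply/andP/eqP => [[qk /eqP <-]|qp]; first by rewrite inordK// ltnW.
  by rewrite qp pk; split => //; apply/eqP/val_inj; rewrite /= inordK.
move=> /andP[/andP[_ qk] /eqP <-]; rewrite inordK//; last exact: ltnW.
by rewrite flow_prefix0 conjby1 scalerA -rmorphM.
Qed.

End MultiIndexExpansion.

(** * The generator of the Trotter error *)

Section TrotterRemainder.
Variables (R : realType) (d : nat).
Local Notation C := R[i].
Local Notation M := 'M[C]_d.

Lemma sumr_subBB (V : zmodType) (I : finType) (f g h l : I -> V) :
  \sum_i (f i - g i) - \sum_i (h i - l i) =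
  (\sum_i f i - \sum_i h i) - (\sum_i g i - \sum_i l i).
Proof.
by rewrite !sumrB !opprB addrACA [in RHS]addrACA [X in _ + X = _]addrC.
Qed.

(** Once the lower coefficients vanish, [F'] is [c] times [(G - s^p B_p) Q + s^p B_p (Q - 1)], of
    order at least [p + 1]. Thus [F = O(s^{p+2})], and as [p + 2 <= k + 1] the degree [p + 1]
    monomial separating [F] from [Q - 1] is too small to be nonzero. *)
Lemma generator_coef_eq0 (G Q : R -> M) (B : nat -> M) (k : nat) (c : C) :
  c != 0 -> (forall s, is_dmx Q s (c *: (G s * Q s))) ->
  mxO k.+1 (fun s => Q s - 1) -> Q 0 = 1 ->
  mxO k (fun s => G s - \sum_(p < k) (s ^+ p)%:C *: B p) ->
  forall p, (p < k)%N -> B p = 0.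
Proof.
move=> c0 dQ Q1 Q0 GB; elim/ltn_ind => p IH pk.
have h1 : mxO p.+1 (fun s => G s - (s ^+ p)%:C *: B p).
  apply: (mxO_ext (F := fun s => (G s - \sum_(r < k) (s ^+ r)%:C *: B r) +
      \sum_(r < k | r != p :> nat) (s ^+ r)%:C *: B r)) => [s|].
    rewrite (bigD1 (Ordinal pk))//= opprD addrA subrK.
    by congr (_ - _).
  apply: mxOD; first exact: mxO_le GB.
  apply: mxO_sum => r rp; have [rltp|] := ltnP r p.
    by apply: mxO_ext (mxO0 _ _ p.+1) => s; rewrite IH// scaler0.
  rewrite leq_eqVlt eq_sym (negbTE rp) /= => pr.
  exact: mxO_le pr (mxO_monomial _ _).
(* The factor [p!] makes the divided power of degree [p + 1] differentiate to [c s^p B_p]. *)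
pose Z := (c * p`!%:R) *: B p.
pose F s := Q s - 1 - (s ^+ p.+1 / p.+1`!%:R)%:C *: Z.
have p0 : p`!%:R != 0 :> C by rewrite pnatr_eq0 -lt0n fact_gt0.
have dF s : is_dmx F s (c *: ((G s - (s ^+ p)%:C *: B p) * Q s
     + ((s ^+ p)%:C *: B p) * (Q s - 1))).
  have h := is_dmxB (is_dmxB (dQ s) (is_dmx_cst 1 s))
    (is_dmxZ (is_derive_divided_power p (is_derive_id s 1)) (is_dmx_cst Z s)).
  apply: is_dmx_eq h _.
  rewrite subr0 scaler0 addr0 mul1r mulrBl mulrBr mulr1 addrA subrK scalerBr.
  congr (_ - _); rewrite /Z !scalerA; congr (_ *: _).
  have -> : (s ^+ p / p`!%:R)%:C = (s ^+ p)%:C / p`!%:R :> C.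
    by rewrite rmorphM fmorphV rmorph_nat.
  by rewrite mulrC -mulrA [X in c * X]mulrC divfK.
have F0 : F 0 = 0 by rewrite /F Q0 subrr expr0n mul0r scale0r subr0.
have hF : mxO p.+2 F.
  apply: (mxO_ext (F := fun s => F s - F 0)) => [s|]; first by rewrite F0 subr0.
  apply: mxO_deriv dF _; apply: mxOZ; apply: mxOD.
    by have := mxOM h1 (is_dmx_mxO (dQ 0)); rewrite addn0.
  apply: (mxO_le (k := (p + k.+1)%N)); first by rewrite addnS ltnS leq_addr.
  exact: mxOM (mxO_monomial _ _) Q1.
have : (p.+1`!%:R^-1)%:C *: Z = 0.
  apply: (@mxO_monomial_eq0 R d p.+1).
  apply: (mxO_ext (F := fun s => (Q s - 1) - F s)) => [s|].
    by rewrite /F opprB addrCA subrr addr0 scalerA -rmorphM.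
  by apply: mxOB hF; exact: mxO_le Q1.
move/eqP; rewrite /Z scalerA scaler_eq0 !mulf_eq0 (negbTE c0) (negbTE p0) !orbF.
rewrite fmorph_eq0 invr_eq0 pnatr_eq0 -leqn0 leqNgt fact_gt0 /=.
by move/eqP.
Qed.

Variables (U k : nat) (Ht : 'I_U -> M).
Hypothesis HtH : forall m, (Ht m)^t* = Ht m.
Hypothesis k_gt0 : (0 < k)%N.

Definition generator (m : 'I_U) : M := - 'i%C *: Ht m.

Lemma generator_adj m : (generator m)^t* = - generator m.
Proof.
rewrite /generator adjZ HtH -scaleNr opprK; congr (_ *: _).
by rewrite [Num.conj _]/(conjc _) /= oppr0 opprK.
Qed.

Lemma generatorK m : 'i%C *: generator m = Ht m.
Proof.
by rewrite scalerA mulrN -expr2 sqr_i opprK scale1r.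
Qed.

Lemma expmx_flow (Y : M) (s : R) : expmx (('i%C * s%:C) *: Y) = flow ('i%C *: Y) s.
Proof. by rewrite /flow scalerA mulrC. Qed.

Lemma expmxN_flow m (s : R) : expmx (- ('i%C * s%:C) *: Ht m) = flow (generator m) s.
Proof. by rewrite /flow scalerA mulrN mulrC. Qed.

Lemma trotterE s : trotter Ht s = flow_prefix generator U s.
Proof.
rewrite /trotter /flow_prefix; apply: eq_big => [m|m _]; first by rewrite ltn_ord.
exact: expmxN_flow.
Qed.

Lemma trotter_unitaryV s : (trotter Ht s)^t* * trotter Ht s = 1.
Proof. by rewrite trotterE flow_prefix_unitaryV//; exact: generator_adj. Qed.

Lemma trotter_deriv s : exists2 D, is_dmx (trotter Ht) s D &
  'i%C *: (D * (trotter Ht s)^t*) =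
  \sum_(j < U) conjby (flow_prefix generator j s) (Ht j).
Proof.
have [D dD DE] := is_dmx_flow_prefix generator_adj s (leqnn U).
have -> : trotter Ht = flow_prefix generator U by apply/funext => t; exact: trotterE.
exists D => //; rewrite DE scaler_sumr.
apply: eq_big => [j|j _]; first by rewrite ltn_ord.
by rewrite -conjbyZ generatorK.
Qed.

Lemma remainder_genE (H : M) s : \sum_(j < U) Ht j = H ->
  remainder_gen H Ht s = \sum_(j < U) conjby (flow_prefix generator j s) (Ht j)
    - \sum_(j < U) conjby (flow_prefix generator U s) (Ht j).
Proof.
move=> <-; rewrite /remainder_gen; have [D dD DE] := trotter_deriv s.
by rewrite (mxderive_val dD) DE trotterE -conjby_sum.
Qed.

(** The conjugate of [H] inside the remainder meets the Trotter product and, by unitarity, becomes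
    the derivative of the exponential factor. *)
Lemma trotter_error_ode (H : M) s :
  is_dmx (fun t => trotter Ht t * expmx (('i%C * t%:C) *: H)) s
    (- 'i%C *: (remainder_gen H Ht s *
       (trotter Ht s * expmx (('i%C * s%:C) *: H)))).
Proof.
have [D dD DE] := trotter_deriv s.
rewrite (_ : (fun t => _) = fun t => trotter Ht t * flow ('i%C *: H) t); last first.
  by apply/funext => t; rewrite expmx_flow.
apply: is_dmx_eq (is_dmxM dD (is_dmx_flow _ s)) _.
rewrite expmx_flow /remainder_gen (mxderive_val dD) mulrBl scalerBr.
rewrite !mulZmx mulmxZ scalerA mulNr -expr2 sqr_i opprK scale1r scaleNr opprK.
by rewrite -!mulrA (mulrA _ (trotter Ht s) (flow _ s)) trotter_unitaryV mul1r.
Qed.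

Lemma mxO_remainder_gen (H : M) : \sum_(j < U) Ht j = H ->
  mxO k.+1 (fun s => trotter Ht s * expmx (('i%C * s%:C) *: H) - 1) ->
  mxO k (remainder_gen H Ht) /\
  forall s, \sum_(j < U) midx_sum k generator 0 j (Ht j) s =
            \sum_(j < U) midx_sum k generator 0 U (Ht j) s.
Proof.
move=> HE ord.
pose B p := \sum_(j < U) midx_coef k generator j (Ht j) p
          - \sum_(j < U) midx_coef k generator U (Ht j) p.
have BE s : \sum_(p < k) (s ^+ p)%:C *: B p =
    \sum_(j < U) midx_sum k generator 0 j (Ht j) s
    - \sum_(j < U) midx_sum k generator 0 U (Ht j) s.
  have E (n : 'I_U -> nat) : \sum_(j < U) midx_sum k generator 0 (n j) (Ht j) s =
      \sum_(p < k) (s ^+ p)%:C *: \sum_(j < U) midx_coef k generator (n j) (Ht j) p.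
    under [RHS]eq_bigr do rewrite scaler_sumr.
    by rewrite exchange_big; apply: eq_bigr => j _; exact: midx_sum_poly.
  rewrite [X in _ = X - _](E (fun j => nat_of_ord j)).
  rewrite [X in _ = _ - X](E (fun=> U)) -sumrB.
  by apply: eq_bigr => p _; rewrite scalerBr.
have GB : mxO k (fun s => remainder_gen H Ht s - \sum_(p < k) (s ^+ p)%:C *: B p).
  apply: (mxO_ext (F := fun s =>
     \sum_(j < U) (conjby (flow_prefix generator j s) (Ht j)
       - midx_sum k generator 0 j (Ht j) s)
     - \sum_(j < U) (conjby (flow_prefix generator U s) (Ht j)
       - midx_sum k generator 0 U (Ht j) s))) => [s|].
    rewrite (remainder_genE s HE).
    rewrite BE.
    exact: sumr_subBB.
  apply: mxOB; apply: mxO_sum => j _; apply: mxO_midx_sum_telescope => //.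
  - exact: generator_adj.
  - exact: ltnW.
  - exact: generator_adj.
have B0 : forall p, (p < k)%N -> B p = 0.
  apply: (generator_coef_eq0 _ (trotter_error_ode H) ord _ GB).
    by rewrite oppr_eq0 neq0Ci.
  by rewrite trotterE expmx_flow flow0 mulr1 /flow_prefix big1// => m _; rewrite flow0.
have S0 s : \sum_(p < k) (s ^+ p)%:C *: B p = 0.
  by rewrite big1// => p _; rewrite B0// scaler0.
split; first by apply: mxO_ext GB => s; rewrite S0 subr0.
by move=> s; apply/eqP; rewrite -subr_eq0 -BE S0.
Qed.

End TrotterRemainder.

(** * Hermiticity of Pauli sums *)

Section PauliHermitian.
Variable R : realType.
Local Notation C := R[i].

Lemma pauli_mx_adj p : (pauli_mx R p)^t* = pauli_mx R p.
Proof.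
apply/matrixP => a b; case: p; rewrite !mxE [Num.conj _]/(conjc _) eq_sym.
- exact: conjc_nat.
- exact: conjc_nat.
- case: (eqVneq a b) => [_|ab]; first by apply: conjc0.
  have -> : (b == 0) = ~~ (a == 0).
    by case: a ab => [[|[|//]]] ?; case: b => [[|[|//]]] ?.
  by case: (a == 0); apply: eq_complexP; rewrite /= ?oppr0 ?opprK.
- case: (eqVneq a b) => [->|_]; last by apply: conjc0.
  by case: (b == 0); apply: eq_complexP; rewrite /= ?oppr0.
Qed.

Lemma pauli_string_adj n (P : 'I_n -> pauli) :
  (pauli_string R P)^t* = pauli_string R P.
Proof.
elim: n P => [|n IH] P /=; first by rewrite trmx1 map_mx1.
by rewrite trmx_cast map_castmx mxtens.trmx_tens mxtens.map_mxT pauli_mx_adj IH.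
Qed.

(** This is what makes the Trotter generators anti-Hermitian and their flows unitary. *)
Lemma commuting_pauli_sum_adj n (A : 'M[C]_(2 ^ n)) :
  commuting_pauli_sum A -> A^t* = A.
Proof.
move=> [m [c [P [_ ->]]]]; rewrite adj_sum; apply: eq_bigr => a _.
by rewrite adjZ conj_real pauli_string_adj.
Qed.

End PauliHermitian.

(** * The terms indexed by nu *)

Section RemainderTerms.
Variables (R : realType) (d : nat).
Local Notation C := R[i].
Local Notation M := 'M[C]_d.

Lemma adZr (X Y : M) (c : C) : ad X (c *: Y) = c *: ad X Y.
Proof. by rewrite /ad mulZmx mulmxZ scalerBr. Qed.

Lemma adZl (X Y : M) (c : C) : ad (c *: X) Y = c *: ad X Y.
Proof. by rewrite /ad mulZmx mulmxZ scalerBr. Qed.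

Lemma iter_adZ (X Y : M) (a c : C) r :
  iter r (ad (a *: X)) (c *: Y) = (c * a ^+ r) *: iter r (ad X) Y.
Proof.
elim: r => [|r IH]; first by rewrite expr0 mulr1.
by rewrite !iterS IH adZr adZl scalerA exprSr mulrA.
Qed.

Lemma foldr_iter_adZ (I : Type) (r : seq I) (f : I -> nat) (X : I -> M) (Y : M)
    (a c : C) :
  foldr (fun m Z => iter (f m) (ad (a *: X m)) Z) (c *: Y) r =
  (c * a ^+ (\sum_(m <- r) f m)) *: foldr (fun m Z => iter (f m) (ad (X m)) Z) Y r.
Proof.
elim: r => [|m r IH] /=; first by rewrite big_nil expr0 mulr1.
by rewrite IH iter_adZ big_cons [in RHS]addnC exprD mulrA.
Qed.

(** Scalars leave each [ad] by bilinearity, and an iterate becomes a block of equal letters, so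
    lengths add up to the sum of the exponents. *)
Lemma foldr_iter_ad_nested (L : nat) (I : Type) (Hl : 'I_L -> M) (r : seq I)
    (f : I -> nat) (w : I -> R) (ell : I -> 'I_L) (c0 : C) (l0 : 'I_L) :
  exists c (ls : seq 'I_L), size ls = (\sum_(m <- r) f m)%N /\
  foldr (fun m Z => iter (f m) (ad ((w m)%:C *: Hl (ell m))) Z) (c0 *: Hl l0) r =
  c *: nested_comm Hl ls l0.
Proof.
elim: r => [|m r [c [ls [sz IH]]]] /=; first by exists c0, [::]; rewrite big_nil.
exists (c * (w m)%:C ^+ f m), (nseq (f m) (ell m) ++ ls).
rewrite size_cat size_nseq big_cons sz; split=> //.
rewrite IH iter_adZ; congr (_ *: _); rewrite /nested_comm foldr_cat.
by elim: (f m) => //= t ->.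
Qed.

Variables (U k : nat) (Ht : 'I_U -> M).
Hypothesis HtH : forall m, (Ht m)^t* = Ht m.
Hypothesis k_gt0 : (0 < k)%N.
Implicit Type nu : midx U k.
Local Notation X := (generator Ht).

Lemma nu_prefixE nu s sigma : nu_prefix Ht nu s sigma =
  flow_prefix X (midx_i nu) s * flow (X (midx_i nu)) sigma.
Proof.
rewrite /nu_prefix expmxN_flow; apply: (congr1 (fun Z => Z * _)).
by apply: eq_bigr => m _; exact: expmxN_flow.
Qed.

Lemma valid_midxE T j i (q : {ffun 'I_U -> 'I_k.+1}) (nu := Midx T j i q) :
  valid_midx nu = (i < midx_n nu)%N && (midx_supp i (midx_n nu) q &&
    ((0 < q i)%N && (midx_wt i (midx_n nu) q == k))).
Proof. by []. Qed.

Lemma sum_filter_enum (P : pred 'I_U) (f : 'I_U -> nat) :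
  (\sum_(m <- [seq m <- enum 'I_U | P m]) f m = \sum_(m < U | P m) f m)%N.
Proof. by rewrite big_filter big_enum_cond. Qed.

(** Each of the [k] commutators takes one factor [-i]; the sign goes to the innermost entry. *)
Lemma nu_commE nu : valid_midx nu -> nu_comm Ht nu =
  midx_ad X (midx_i nu) (midx_n nu) (midx_q nu) (nu_sign R nu *: Ht (midx_j nu)).
Proof.
move=> /and4P[_ _ _ /eqP wt]; rewrite /midx_ad /generator foldr_iter_adZ.
by rewrite sum_filter_enum wt.
Qed.

Lemma mxO_flow_prefix_sub1 (p : nat) : (p <= U)%N ->
  mxO 1 (fun s => flow_prefix X p s - 1).
Proof.
move: p; apply: flow_prefix_ind => [|m IH].
  by apply: mxO_ext (mxO0 _ _ _) => s; rewrite flow_prefix0 subrr.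
apply: (mxO_ext (F := fun s =>
  (flow_prefix X m s - 1) * flow (X m) s + (flow (X m) s - 1))).
  by move=> s; rewrite flow_prefixS mulrBl mul1r addrA subrK.
apply: mxOD; last exact: mxO_flow_sub1.
by rewrite -[1%N]addn0; apply: mxOM IH _; exact: is_dmx_mxO (is_dmx_flow _ _).
Qed.

Lemma nu_prefix_near1 nu : exists c : R, \forall s \near (0 : R), forall sigma : R,
  0 <= sigma <= s -> opnorm (nu_prefix Ht nu s sigma - 1) <= c * s.
Proof.
have /mxO_pos[c1 c10 [e1 e10 h1]] := mxO_flow_prefix_sub1 (ltnW (ltn_ord (midx_i nu))).
have /mxO_pos[c2 c20 [e2 e20 h2]] := mxO_flow_sub1 (X (midx_i nu)).
have /mxO_pos[c3 c30 [e3 e30 h3]] := is_dmx_mxO (is_dmx_flow (X (midx_i nu)) 0).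
(* From [A B - 1 = (A - 1) B + (B - 1)]: [c1] and [c2] bound the differences, [c3] bounds [B], and 2
   passes to [opnorm]. *)
exists (2 * (c1 * c3 + c2)).
apply/nbhs_ballP; exists (Num.min e1 (Num.min e2 e3)).
  by rewrite /= !lt_min e10 e20 e30.
move=> s; rewrite /ball/= sub0r normrN !lt_min => /and3P[se1 se2 se3].
move=> sigma /andP[sg0 sgs]; have s0 : 0 <= s := le_trans sg0 sgs.
have lt_s e : `|s| < e -> `|sigma| < e.
  by apply: le_lt_trans; rewrite !ger0_norm.
apply: le_trans (opnorm_le_mnorm _) _; rewrite -mulrA ler_wpM2l//.
have -> : nu_prefix Ht nu s sigma - 1 =
    (flow_prefix X (midx_i nu) s - 1) * flow (X (midx_i nu)) sigma
    + (flow (X (midx_i nu)) sigma - 1).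
  by rewrite nu_prefixE mulrBl mul1r addrA subrK.
apply: le_trans (ler_mnormD _ _) _; rewrite [leRHS]mulrDl lerD//.
  apply: le_trans (ler_mnormM _ _) _.
  have := h1 _ se1; have := h3 _ (lt_s _ se3).
  rewrite expr0 expr1 mulr1 ger0_norm// => a3 a1.
  by rewrite mulrAC; apply: ler_pM; rewrite ?mnorm_ge0.
apply: le_trans (h2 _ (lt_s _ se2)) _; rewrite expr1 ger0_norm//.
exact: ler_wpM2l.
Qed.

Lemma nu_kernel_ge0 nu (s sigma : R) : 0 <= sigma <= s -> 0 <= nu_kernel nu s sigma.
Proof.
move=> /andP[sg0 sgs]; rewrite /nu_kernel divr_ge0// mulr_ge0// exprn_ge0//.
  by rewrite subr_ge0.
exact: le_trans sgs.
Qed.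

Lemma Rintegral_nu_kernel nu (s : R) : valid_midx nu -> 0 <= s ->
  \int[@lebesgue_measure R]_(sigma in `[0, s]) nu_kernel nu s sigma
    = s ^+ k * nu_weight R nu.
Proof.
move=> /and4P[i_n _ q0 /eqP wt] s0.
set i := midx_i nu in i_n q0 wt *; set n := midx_n nu in i_n wt *.
set q := midx_q nu in q0 wt *.
(* As its own update at [i], [q] fits the lemmas that split off one entry. *)
have qE : midx_upd q i (q i) = q.
  by apply/ffunP => m; rewrite ffunE; case: eqP => [->|].
have wtE : (q i + midx_wt i.+1 n q)%N = k.
  by have := midx_wt_upd q (q i) i_n; rewrite qE => <-.
have fE : midx_fact i n q = ((q i)`! * midx_fact i.+1 n q)%N.
  by have := midx_fact_upd q (q i) i_n; rewrite qE => ->.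
case qiE : (nat_of_ord (q i)) q0 => [//|t] _.
pose c := s ^+ midx_wt i.+1 n q / (midx_fact i.+1 n q)%:R.
have kE x : nu_kernel nu s x = (s - x) ^+ t * c / t`!%:R.
  rewrite /nu_kernel -/i -/q -/n qiE /= natrM invfM /c.
  by rewrite -/(midx_wt i.+1 n q) -/(midx_fact i.+1 n q) !mulrA mulrAC.
have ds (x : R) : is_derive x 1 (fun t => s - t) (-1).
  have := is_deriveB (is_derive_cst s x 1) (is_derive_id x 1); rewrite sub0r; exact.
(* This primitive vanishes at [s]; its value at 0 turns [(q_i - 1)!] into [q_i!]. *)
pose F (x : R) := - c * ((s - x) ^+ t.+1 / t.+1`!%:R).
have dF (x : R) : is_derive x 1 F (nu_kernel nu s x).
  have := is_deriveZ (- c) (is_derive_divided_power t (ds x)).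
  by move=> h; apply: is_derive_eq h _; rewrite kE /GRing.scale/= mulN1r mulrNN; ring.
have cK : continuous (nu_kernel nu s).
  move=> x; apply: differentiable_continuous; apply/derivable1_diffP.
  have [df h] := ex_derive_power_scale t c t`!%:R s x.
  by rewrite (_ : nu_kernel nu s = fun x => (s - x) ^+ t * c / t`!%:R)//; apply/funext.
rewrite (Rintegral_FTC s0 dF cK) /F subrr expr0n mul0r mulr0 sub0r mulNr opprK subr0.
have -> : s ^+ k = s ^+ t.+1 * s ^+ midx_wt i.+1 n q by rewrite -qiE -exprD wtE.
rewrite /nu_weight -/(midx_fact i n q) fE natrM invfM qiE /c.
by rewrite mulrC mulrACA.
Qed.

(** The value of [midx_n], available in an iterated sum before [i] and [q] are chosen. *)
Definition tag_len (T : ttag) (j : 'I_U) : nat := if T is TL then j else U.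

Lemma sum_midx (V : nmodType) (F : midx U k -> V) :
  \sum_(nu | valid_midx nu) F nu = \sum_(T : ttag) \sum_(j < U)
    \sum_(i < U | (i < tag_len T j)%N)
    \sum_(q | midx_supp i (tag_len T j) q &&
       ((0 < q i)%N && (midx_wt i (tag_len T j) q == k)))
      F (Midx T j i q).
Proof.
rewrite pair_big_dep pair_big_dep pair_big_dep /=.
rewrite (reindex (fun x : ttag * 'I_U * 'I_U * {ffun 'I_U -> 'I_k.+1} =>
  Midx x.1.1.1 x.1.1.2 x.1.2 x.2)) /=; last first.
  exists (@midx_to_prod U k) => [[[[T j] i] q]|[T j i q]] //.
by apply: eq_bigl => -[[[T j] i] q]; rewrite valid_midxE.
Qed.

Lemma sum_ttag (V : nmodType) (F : ttag -> V) : \sum_T F T = F TL + F TS.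
Proof.
rewrite (bigD1 TL)//= (bigD1 TS)//= big1 ?addr0// => T.
by case: T.
Qed.

Lemma midx_adZ p n (q : {ffun 'I_U -> 'I_k.+1}) (c : C) (Y : M) :
  midx_ad X p n q (c *: Y) = c *: midx_ad X p n q Y.
Proof.
rewrite /midx_ad; elim: [seq _ <- _ | _] => //= m r ->.
by elim: (nat_of_ord (q m)) => //= t ->; rewrite adZr.
Qed.

Lemma midx_sumZ p n (c : C) (Y : M) s :
  midx_sum k X p n (c *: Y) s = c *: midx_sum k X p n Y s.
Proof.
rewrite /midx_sum scaler_sumr; apply: eq_bigr => q _.
by rewrite midx_adZ conjbyZ !scalerA mulrC.
Qed.

Lemma telescope_nu T (j : 'I_U) (s : R) (n := tag_len T j)
    (e : C := if T is TL then 1 else -1) : 0 <= s ->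
  e *: (conjby (flow_prefix X n s) (Ht j) - midx_sum k X 0 n (Ht j) s) =
  \sum_(i < U | (i < n)%N)
    \sum_(q : {ffun 'I_U -> 'I_k.+1} |
           midx_supp i n q && ((0 < q i)%N && (midx_wt i n q == k)))
      mxint 0 s (fun sigma => (nu_kernel (Midx T j i q) s sigma)%:C *:
        (nu_prefix Ht (Midx T j i q) s sigma * nu_comm Ht (Midx T j i q)
          * (nu_prefix Ht (Midx T j i q) s sigma)^t*)).
Proof.
move=> s0; have nU : (n <= U)%N by rewrite /n /tag_len; case: (T) => //; exact: ltnW.
rewrite scalerBr -conjbyZ -midx_sumZ.
rewrite (midx_sum_telescope (generator_adj HtH) (e *: Ht j) nU k_gt0 s0).
apply: eq_bigr => i i_n; apply: eq_bigr => q hq; apply: (congr1 (mxint 0 s)).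
have vnu : valid_midx (Midx T j i q) by rewrite valid_midxE i_n.
by apply/funext => sigma; rewrite nu_prefixE (nu_commE vnu).
Qed.

Lemma remainder_gen_integral (H : M) s : \sum_(j < U) Ht j = H ->
  (forall s, \sum_(j < U) midx_sum k X 0 j (Ht j) s =
             \sum_(j < U) midx_sum k X 0 U (Ht j) s) ->
  0 <= s ->
  remainder_gen H Ht s = \sum_(nu : midx U k | valid_midx nu)
    mxint 0 s (fun sigma => (nu_kernel nu s sigma)%:C *:
      (nu_prefix Ht nu s sigma * nu_comm Ht nu * (nu_prefix Ht nu s sigma)^t*)).

Proof.
move=> HE S0 s0; rewrite (remainder_genE HtH _ HE) sum_midx sum_ttag.
(* The S polynomial is inserted; against the L conjugates it is exchanged for the equal L polynomial
   by [S0]. *)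
rewrite -[LHS](subrKA (\sum_(j < U) midx_sum k X 0 U (Ht j) s)).
apply: (congr2 +%R).
  apply: etrans (congr1 (fun Z => _ - Z) (esym (S0 s))) _.
  rewrite -sumrB; apply: eq_bigr => j _; apply: etrans (telescope_nu TL j s0).
  by rewrite scale1r.
rewrite -sumrB; apply: eq_bigr => j _; apply: etrans (telescope_nu TS j s0).
by rewrite scaleN1r opprB.
Qed.

End RemainderTerms.

Theorem lemma2 (R : realType) (n L U k : nat)
    (Hl : 'I_L -> 'M[R[i]]_(2 ^ n)) (H : 'M[R[i]]_(2 ^ n))
    (omega : 'I_U -> R) (ell : 'I_U -> 'I_L)
    (Hpauli : forall l, commuting_pauli_sum (Hl l))
    (Hsum : H = \sum_(l < L) Hl l)
    (k_gt0 : (0 < k)%N)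
    (Htrotter : trotter_order k H (trotter_term Hl omega ell)) :
  let Ht := trotter_term Hl omega ell in
  let G := remainder_gen H Ht in
  [/\ forall s : R, 0 <= s ->
        G s = \sum_(nu : midx U k | valid_midx nu)
                mxint 0 s (fun sigma =>
                  (nu_kernel nu s sigma)%:C *:
                    (nu_prefix Ht nu s sigma * nu_comm Ht nu * (nu_prefix Ht nu s sigma)^t*)),
      forall nu : midx U k, valid_midx nu ->
        exists (c : R[i]) (ls : k.-tuple 'I_L) (l0 : 'I_L),
          nu_comm Ht nu = c *: nested_comm Hl ls l0,
      forall nu : midx U k, valid_midx nu ->
        exists c : R, \forall s \near (0 : R), forall sigma : R,
          0 <= sigma <= s -> opnorm (nu_prefix Ht nu s sigma - 1) <= c * s,
      forall nu : midx U k, valid_midx nu -> forall s : R, 0 <= s ->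
        (forall sigma : R, 0 <= sigma <= s -> 0 <= nu_kernel nu s sigma) /\
        \int[@lebesgue_measure R]_(sigma in `[0, s]) nu_kernel nu s sigma
          = s ^+ k * nu_weight R nu
    & (fun s : R => opnorm (G s)) =O_ (0 : R) (fun s : R => s ^+ k)].

Proof.
move=> Ht G.
have HtH m : (Ht m)^t* = Ht m.
  by rewrite /Ht /trotter_term adjZ conj_real (commuting_pauli_sum_adj (Hpauli _)).
have [HE ordO] := Htrotter.
have ord : mxO k.+1 (fun s => trotter Ht s * expmx (('i%C * s%:C) *: H) - 1).
  have /eqO_exP[c c0 /nbhs_ballP[e /= e0 he]] := ordO.
  exists ((2 * 2 ^ n * 2 ^ n)%:R * c), e => // s se.
  have /he : ball 0 e s by rewrite /ball/= sub0r normrN.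
  rewrite normrX => hs; apply: le_trans (mnorm_le_opnorm _) _.
  by rewrite -mulrA ler_wpM2l// (le_trans (ler_norm _)).
have [GO S0] := mxO_remainder_gen HtH k_gt0 HE ord.
split.
- by move=> s s0; exact: remainder_gen_integral.
- move=> nu /and4P[_ _ _ /eqP wt].
  have [c [ls [sz E]]] := foldr_iter_ad_nested Hl
    [seq m : 'I_U <- enum 'I_U | (midx_i nu <= m < midx_n nu)%N]
    (fun m => midx_q nu m) omega ell (omega (midx_j nu))%:C (ell (midx_j nu)).
  rewrite sum_filter_enum wt in sz.
  exists (nu_sign R nu * (- 'i%C) ^+ k * c), (Tuple (introT eqP sz)), (ell (midx_j nu)).
  by rewrite -scalerA -E.
- by move=> nu _; exact: nu_prefix_near1.
- move=> nu vnu s s0; split; first exact: nu_kernel_ge0.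
  exact: Rintegral_nu_kernel.
(* The bound is two-sided, so it comes from the order estimate and not from the integral formula. *)
- have [c [e e0 he]] := GO; apply/eqO_exP.
  (* The 2 compares [opnorm] with [mnorm]; the 1 makes the constant strictly positive. *)
  exists (2 * `|c| + 1); first by rewrite ltr_wpDl// mulr_ge0.
  apply/nbhs_ballP; exists e => // s; rewrite /ball/= sub0r normrN => /he hs.
  rewrite ger0_norm ?opnorm_ge0// normrX; apply: le_trans (opnorm_le_mnorm _) _.
  rewrite [leRHS]mulrDl mul1r -[X in _ <= X + _]mulrA ler_wpDr ?exprn_ge0// ler_wpM2l//.
  by apply: le_trans hs _; rewrite ler_wpM2r ?exprn_ge0// ler_norm.
Qed.
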